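(* Let $r,p,\tau,\alpha,\beta$ be as in the context, and consider the equation $$(E)\qquad (r(t)\Phi(y'))'=p(t)\Phi(y(\tau(t))).$$ **(I)** Assume that $\int_a^\infty p(s)\,ds=\infty$ and $$\lim_{t\to\infty}\frac{t^{\alpha-1}}{r(t)}\int_a^t p(s)\,ds=0.$$ Then $\mathcal{IS}\subset\mathcal{NSV}$. If, in addition, $p\in\mathcal{RV}(\delta)$ with $\delta>-1$, then for any $y\in\mathcal{IS}$ the following hold. (i) If $\int_a^\infty G(s)\,ds=\infty$, then $$y(t)=\exp\left\{\int_a^t(1+o(1))\frac{G(s)}{\Phi^{-1}(\delta+1)}\,ds\right\}\quad\text{as } t\to\infty.$$ Moreover, $\mathcal S_{\mathcal{NSV}}=\mathcal S_{\mathcal{SV}}=\mathcal{IS}=\mathcal{IS}_{\infty,\infty}$. (ii) If $\int_a^\infty G(s)\,ds<\infty$, then $$y(t)=N\exp\left\{-\int_t^\infty(1+o(1))\frac{G(s)}{\Phi^{-1}(\delta+1)}\,ds\right\}\quad\text{as } t\to\infty,$$ where $N:=\lim_{t\to\infty}y(t)\in(0,\infty)$. Moreover, $\mathcal S_{\mathcal{NSV}}=\mathcal S_{\mathcal{SV}}=\mathcal{IS}=\mathcal{IS}_{B,\infty}$. **(II)** Let all the conditions of (I) be satisfied (that is, $\int_a^\infty p(s)\,ds=\infty$, $\lim_{t\to\infty}\frac{t^{\alpha-1}}{r(t)}\int_a^tp(s)\,ds=0$, and $p\in\mathcal{RV}(\delta)$ with $\delta>-1$) and let $r\in\mathcal{RV}(\gamma)$.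 Then $\gamma\ge\alpha+\delta$. For any $y\in\mathcal{IS}$ it holds that $y\in\Pi(ty'(t))$ provided $\gamma=\alpha+\delta$. Moreover, if either $\gamma=\alpha+\delta$ and $\int_a^\infty G(s)\,ds<\infty$, or $\gamma>\alpha+\delta$, then, with $N=\lim_{t\to\infty}y(t)\in(0,\infty)$, the function $N-y$ satisfies $$N-y(t)\sim\frac{N}{\Phi^{-1}(\delta+1)}\int_t^\infty G(s)\,ds\in\mathcal{RV}\big((\delta+1-\gamma)(\beta-1)+1\big)\quad\text{as } t\to\infty.$$ In particular, if $\gamma=\alpha+\delta$ (and $\int_a^\infty G(s)\,ds<\infty$), then $|N-y|\in\mathcal{SV}$ and $$\frac{L_p^{\beta-1}(t)}{L_r^{\beta-1}(t)(N-y(t))}=o(1)\quad\text{as } t\to\infty.$$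
   Context: Setting. $a>0$; $r,p:[a,\infty)\to(0,\infty)$ are continuous; $\alpha>1$, $\Phi(u)=|u|^{\alpha-1}\operatorname{sgn}u$, $\Phi^{-1}$ is its inverse; $\beta$ is the conjugate number of $\alpha$, $1/\alpha+1/\beta=1$ (so $\Phi^{-1}(u)=|u|^{\beta-1}\operatorname{sgn}u$). The delay $\tau$ on $[a,\infty)$ satisfies $\tau\in C^1$, $\tau'>0$, $\tau(t)\le t$, and $\limsup_{t\to\infty}t/\tau(t)<\infty$ (hence $\tau(t)\to\infty$). Put $G(t)=\Phi^{-1}\big(tp(t)/r(t)\big)=(tp(t)/r(t))^{\beta-1}$. Solutions. A solution $y$ of (E) is a $C^1$ function on an interval $I\subseteq[a,\infty)$ with $r\Phi(y')\in C^1(I)$ satisfying the equation. $\mathcal S$ is the set of $y$ that are positive solutions of (E) for all large $t$. $\mathcal{IS}=\{y\in\mathcal S: y'(t)>0\text{ for large }t\}$. Quasiderivative: $y^{[1]}=r\Phi(y')$. For $u,v\in\{B,\infty\}$, $\mathcal{IS}_{u,v}=\{y\in\mathcal{IS}:\lim_{t\to\infty}y(t)=u,\ \lim_{t\to\infty}y^{[1]}(t)=v\}$, where the value $B$ means that the corresponding limit is a finite nonzero real number. Regular variation. A measurable $f:[a,\infty)\to(0,\infty)$ (positivity and all statements for large $t$ suffice) is in $\mathcal{RV}(\vartheta)$, $\vartheta\in\mathbb R$, if $\lim_{t\to\infty}f(\lambda t)/f(t)=\lambda^\vartheta$ for every $\lambda>0$; $\mathcal{SV}=\mathcal{RV}(0)$.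 For $f\in\mathcal{RV}(\vartheta)$, $L_f(t)=f(t)/t^\vartheta$. $f\in\mathcal{NRV}(\vartheta)$ (normalized) if $f(t)=Ct^\vartheta\exp\{\int_{t_0}^t\psi(s)/s\,ds\}$ for large $t$, with $C\in(0,\infty)$ and $\psi$ measurable, $\psi(t)\to0$; for $f\in C^1$ this is equivalent to $tf'(t)/f(t)\to\vartheta$. $\mathcal{NSV}=\mathcal{NRV}(0)$. $\mathcal S_{\mathcal{SV}}=\mathcal S\cap\mathcal{SV}$, $\mathcal S_{\mathcal{NSV}}=\mathcal S\cap\mathcal{NSV}$. A measurable real function $f$ belongs to the de Haan class $\Pi(w)$, with $w$ positive, if $\lim_{t\to\infty}(f(\lambda t)-f(t))/w(t)=\ln\lambda$ for every $\lambda>0$. Conventions. $f\sim g$ means $f(t)/g(t)\to1$ as $t\to\infty$. Inside an integral in the variable $s$, $1+o(1)$ stands for $1+\varepsilon(s)$ for some function $\varepsilon$ with $\varepsilon(s)\to0$ as $s\to\infty$; the formulas hold for all large $t$. *)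

(* Defs.v *)
From HB Require Import structures.
From mathcomp Require Import all_boot all_order all_algebra.
From mathcomp Require Import ring.
From mathcomp Require Import all_classical all_reals all_analysis.

Set Implicit Arguments.
Unset Strict Implicit.
Unset Printing Implicit Defensive.

Import Order.TTheory GRing.Theory Num.Theory.
Import numFieldNormedType.Exports.

Local Open Scope classical_set_scope.
Local Open Scope ring_scope.

Definition Phi {R : realType} (alpha u : R) : R :=
  Num.sg u * `|u| `^ (alpha - 1).

(* For conjugate exponents, Phi beta is the two-sided inverse of Phi alpha
   (exchange the roles of alpha and beta for the other side). *)
Lemma PhiK (R : realType) (alpha beta : R) :
  1 < alpha -> alpha^-1 + beta^-1 = 1 -> cancel (Phi alpha) (Phi beta).
Proof.
move=> alpha1 ab u.
have alpha0 : alpha != 0 by rewrite gt_eqF// (lt_trans ltr01).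
have beta0 : beta != 0.
  apply/negP => /eqP b0; move: ab; rewrite b0 invr0 addr0 => /(congr1 GRing.inv).
  by rewrite invrK invr1 => a1; move: alpha1; rewrite a1 ltxx.
have ab1 : (alpha - 1) * (beta - 1) = 1.
  have : alpha * beta * (alpha^-1 + beta^-1) = alpha * beta by rewrite ab mulr1.
  rewrite mulrDr mulrAC divff// mul1r mulfK// => e.
  by rewrite mulrBl mul1r mulrBr mulr1 -e; ring.
rewrite /Phi; have [->|u0] := eqVneq u 0; first by rewrite sgr0 !mul0r sgr0 mul0r.
have p0 : 0 < `|u| `^ (alpha - 1) by rewrite powR_gt0// normr_gt0.
by rewrite sgrM sgr_id (gtr0_sg p0) mulr1 normrM normr_sg u0 mul1r (gtr0_norm p0)
  -powRrM ab1 powRr1// -numEsg.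
Qed.

(* f is of class C^1 on I with derivative df; at an endpoint belonging to I the
   derivative is one-sided, as z stays in I. *)
Definition C1_on {R : realType} (I : set R) (f df : R -> R) : Prop :=
  {within I, continuous df} /\
  forall x, I x ->
    (f z - f x) / (z - x) @[z --> within (I `\ x) (nbhs x)] --> df x.

Lemma C1_on_is_derive (R : realType) (T : R) (f df : R -> R) :
  C1_on `[T, +oo[ f df -> forall t, T < t -> is_derive t 1 f (df t).
Proof.
move=> [_ fdf] t Tt.
have It : [set` `[T, +oo[ ] t by rewrite /= in_itv/= andbT ltW.
have cvgq : h^-1 *: (f (h *: 1 + t) - f t) @[h --> 0^'] --> df t.
  move=> U /(fdf t It); rewrite /= !near_simpl => Ut.
  have Ut' : \forall z \near t, z != t -> U ((f z - f t) / (z - t)).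
    have nT : \forall z \near t, T < z by move: Tt => /lt_nbhsr.
    have {}Ut : \forall z \near t, (`[T, +oo[ `\ t) z ->
        U ((f z - f t) / (z - t)) by exact: Ut.
    apply: (filterS _ (filterI Ut nT)) => z [H Tz].
    move=> zt; apply: H; split; first by rewrite /= in_itv/= andbT ltW.
    by move=> /= /eqP; rewrite (negbTE zt).
  have : \forall h \near (0 : R), h + t != t -> U ((f (h + t) - f t) / (h + t - t)).
    have : (h + t) @[h --> (0 : R)] --> t.
      by rewrite -{2}(add0r t); apply: cvgD; [exact: cvg_id|exact: cvg_cst].
    by move=> /(_ _ Ut').
  rewrite /dnbhs /within /=; apply: filterS => h H h0.
  have ht : h + t != t by rewrite -subr_eq0 addrK.
  by move: (H ht); rewrite addrK mulrC /GRing.scale /= mulr1.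
by apply: DeriveDef; [apply/cvg_ex; exists (df t)|exact: cvg_lim].
Qed.

(* y is a total function; when tau t falls outside I, the value y (tau t) acts as
   initial data. For solutions on half-lines this only matters near the left
   endpoint, since tau tends to +oo. *)
Definition is_solution {R : realType} (a alpha : R) (r p tau : R -> R)
    (I : set R) (y : R -> R) : Prop :=
  [/\ is_interval I, I `<=` `[a, +oo[ &
    exists dy dq : R -> R,
      [/\ C1_on I y dy,
          C1_on I (fun t => r t * Phi alpha (dy t)) dq &
          forall t, I t -> dq t = p t * Phi alpha (y (tau t))]].

Definition solS {R : realType} (a alpha : R) (r p tau : R -> R) :
    set (R -> R) :=
  [set y | exists T, is_solution a alpha r p tau `[T, +oo[ y /\
                     forall t, T <= t -> 0 < y t].

Definition solIS {R : realType} (a alpha : R) (r p tau : R -> R) :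
    set (R -> R) :=
  [set y | solS a alpha r p tau y /\ \forall t \near +oo, 0 < derive1 y t].

Definition quasi {R : realType} (alpha : R) (r y : R -> R) : R -> R :=
  fun t => r t * Phi alpha (derive1 y t).

(* LimB: a finite nonzero limit; LimInf: the limit +oo. *)
Inductive limval := LimB | LimInf.

Definition has_limval {R : realType} (f : R -> R) (u : limval) : Prop :=
  match u with
  | LimB => exists2 l : R, l != 0 & f t @[t --> +oo] --> l
  | LimInf => f t @[t --> +oo] --> +oo
  end.

Definition solISlim {R : realType} (a alpha : R) (r p tau : R -> R)
    (u v : limval) : set (R -> R) :=
  [set y | [/\ solIS a alpha r p tau y, has_limval y u &
               has_limval (quasi alpha r y) v]].

(* Positivity and measurability are required on some half-line [T, +oo[ only, as
   members of solS are unconstrained before some T. *)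
Definition RV {R : realType} (theta : R) : set (R -> R) :=
  [set f : R -> R | (exists T : R, measurable_fun `[T, +oo[ f /\
                      forall t, T <= t -> 0 < f t) /\
    forall lambda, 0 < lambda ->
      f (lambda * t) / f t @[t --> +oo] --> lambda `^ theta].

Definition SV {R : realType} : set (R -> R) := RV 0.

Definition Lpart {R : realType} (theta : R) (f : R -> R) : R -> R :=
  fun t => f t / t `^ theta.

Definition NRV {R : realType} (theta : R) : set (R -> R) :=
  [set f : R -> R | exists (t0 C : R) (psi : R -> R),
    [/\ 0 < t0, 0 < C, measurable_fun `[t0, +oo[ psi,
        psi s @[s --> +oo] --> 0 &
        \forall t \near +oo,
          (@lebesgue_measure R).-integrable `[t0, t]
            (fun s => (psi s / s)%:E) /\
          f t = C * t `^ theta *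
            expR (\int[@lebesgue_measure R]_(s in `[t0, t]) (psi s / s))]].

Definition NSV {R : realType} : set (R -> R) := NRV 0.

Definition dehaan_Pi {R : realType} (w : R -> R) : set (R -> R) :=
  [set f : R -> R | [/\ exists T : R, measurable_fun `[T, +oo[ f,
               \forall t \near +oo, 0 < w t &
    forall lambda, 0 < lambda ->
      (f (lambda * t) - f t) / w t @[t --> +oo] --> ln lambda]].

Definition asymp {R : realType} (f g : R -> R) : Prop :=
  f t / g t @[t --> +oo] --> (1 : R).

(* Phi beta plays the role of the inverse of Phi alpha, see PhiK. *)
Definition Gfun {R : realType} (beta : R) (r p : R -> R) : R -> R :=
  fun t => Phi beta (t * p t / r t).

(* Main.v *)
(* Along an increasing solution the quasiderivative q = r Phi(y') satisfies
   q <= 2 P y^(alpha-1) eventually, where P is the primitive of p: indeed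
   q - P y^(alpha-1) is nonincreasing and P is unbounded. The smallness of
   t^(alpha-1) P / r then gives t y'/y -> 0, so y is normalized slowly varying and
   y(tau t) ~ y(t), as t / tau(t) is bounded. If p is regularly varying, Karamata's
   theorem P ~ t p / (delta+1) and l'Hopital's rule yield q ~ P y^(alpha-1), that is
   y'/y ~ G / Phi^-1(delta+1); integrating gives the representations. A decreasing
   slowly varying solution is impossible: P y^(alpha-1) - q would be nonincreasing
   and q negative, so P y^(alpha-1) would be bounded, although it is regularly
   varying of index delta+1 > 0. In part (II), y' is regularly varying of the same
   index as G, and the claims are Karamata-type facts on its primitives y and N - y.
   For continuous functions Karamata's theorem reduces to comparing derivatives, once
   convergence in the definition of regular variation is known to be locally uniform. *)

Require Import Defs.
From HB Require Import structures.
From mathcomp Require Import all_boot all_order all_algebra.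
From mathcomp Require Import ring lra.
From mathcomp Require Import all_classical all_reals all_analysis measurable_realfun.

Set Implicit Arguments.
Unset Strict Implicit.
Unset Printing Implicit Defensive.

Import Order.TTheory GRing.Theory Num.Theory.
Import numFieldNormedType.Exports.

Local Open Scope classical_set_scope.
Local Open Scope ring_scope.

(** * Monotonicity and l'Hopital's rule at infinity *)

(** The delay forces two passes. At the outset [y (tau t)] is controlled only through [tau t <= t]
    and the monotonicity of [y], which is enough for a one-sided bound with a wasteful constant.
    Slow variation follows from that bound, and only slow variation makes [y (tau t) / y t] tend to
    1, the input of the exact asymptotics of [q]. A second obstacle is that a solution is controlled
    only beyond an unspecified threshold, whereas the integral in the first representation starts at
    [a]. The [1 + o(1)] is therefore an explicit function, altered on an initial segment so that the
    formula is exact. Both l'Hopital rules, for 0/0 and for infinite limits, come from one estimate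
    on increments. Baire's theorem enters once, to make regular variation locally uniform; the
    scaling behaviour of a primitive [F] of [f] does without it, and only the comparison of
    [F (l * t) - F t] with [t * f t] uses it. *)

Lemma near_pinftyP (R : realType) (P : R -> Prop) (A : R) :
  (\forall t \near +oo, P t) -> exists2 T, A <= T & forall t, T <= t -> P t.
Proof.
move=> [M [_ MP]]; exists (Num.max A (M + 1)); first by rewrite le_max lexx.
by move=> t; rewrite ge_max => /andP[_ Mt]; apply: MP; rewrite (lt_le_trans _ Mt)// ltrDl.
Qed.

Lemma near_ge (R : realType) (T : R) (P : R -> Prop) :
  (forall t, T <= t -> P t) -> \forall t \near +oo, P t.
Proof. by move=> H; near=> t; apply: H; near: t; apply: nbhs_pinfty_ge; exact: num_real. Unshelve. end_near. Qed.

Lemma is_derive_continuous (R : realType) (f : R -> R) (x d : R) :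
  is_derive x 1 f d -> {for x, continuous f}.
Proof. by move=> [df _]; apply: differentiable_continuous; exact/derivable1_diffP. Qed.

Lemma le_of_derive_ge0 (R : realType) (f df : R -> R) (s t : R) : s <= t ->
  (forall x, s <= x <= t -> is_derive x 1 f (df x)) ->
  (forall x, s <= x <= t -> 0 <= df x) -> f s <= f t.
Proof.
move=> st fdf df0.
have [| |c] := @MVT_segment R f df s t st.
- by move=> x; rewrite in_itv/= => /andP[/ltW sx /ltW xt]; apply: fdf; rewrite sx xt.
- apply: continuous_in_subspaceT => x; rewrite inE/= in_itv/= => /fdf.
  exact: is_derive_continuous.
- rewrite in_itv/= => /df0 dfc e; rewrite -subr_ge0 e mulr_ge0// subr_ge0//.
Qed.

Lemma lt_of_derive_gt0 (R : realType) (f df : R -> R) (s t : R) : s < t ->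
  (forall x, s <= x <= t -> is_derive x 1 f (df x)) ->
  (forall x, s <= x <= t -> 0 < df x) -> f s < f t.
Proof.
move=> st fdf df0.
have [| |c] := @MVT R f df s t st.
- by move=> x; rewrite in_itv/= => /andP[/ltW sx /ltW xt]; apply: fdf; rewrite sx xt.
- apply: continuous_in_subspaceT => x; rewrite inE/= in_itv/= => /fdf.
  exact: is_derive_continuous.
- rewrite in_itv/= => /andP[/ltW sc /ltW ct] e.
  by rewrite -subr_gt0 e mulr_gt0 ?subr_gt0// df0// sc ct.
Qed.

(** Source of both l'Hopital rules: with [s] fixed and [g t] large it yields the case of an infinite
    limit, and passing to the limit in [t] for each [s] yields the case 0/0. *)
Lemma lhopital_increments (R : realType) (f df g dg : R -> R) (l e : R) :
  (\forall t \near +oo, is_derive (t : R) 1 f (df t)) ->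
  (\forall t \near +oo, is_derive (t : R) 1 g (dg t)) ->
  (\forall t \near +oo, 0 < dg t) ->
  df t / dg t @[t --> +oo] --> l -> 0 < e ->
  exists T, forall s t, T <= s -> s <= t ->
    `|f t - f s - l * (g t - g s)| <= e * (g t - g s).
Proof.
move=> fdf gdg dg0 fgl e0.
have : \forall t \near +oo, [/\ is_derive (t : R) 1 f (df t), is_derive t 1 g (dg t),
    0 < dg t & `|l - df t / dg t| <= e].
  near=> t; split; try by near: t.
  by near: t; move/cvgrPdist_le : fgl; exact.
move=> /(near_pinftyP 0)[T _ H]; exists T => s t Ts st.
have key (c : R) (b : R) : (forall x, s <= x <= t -> 0 <= b * df x + c * dg x) ->
    b * f s + c * g s <= b * f t + c * g t.
  move=> h; apply: (@le_of_derive_ge0 R (fun x => b * f x + c * g x)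
     (fun x => b * df x + c * dg x) s t st) => // x /andP[sx xt].
  have [fx gx _ _] := H x (le_trans Ts sx).
  apply: is_deriveD.
have bnd x : s <= x <= t -> `|l * dg x - df x| <= e * dg x.
  move=> /andP[sx _]; have [_ _ dgx fg] := H x (le_trans Ts sx).
  have -> : l * dg x - df x = (l - df x / dg x) * dg x.
    by rewrite mulrBl divfK ?gt_eqF.
  by rewrite normrM (gtr0_norm dgx) ler_wpM2r// ltW.
(* The functions [f + (e - l) * g] and [(e + l) * g - f] are nondecreasing; their increments are the
   two halves of the absolute value bound. *)
have k1 := key (e - l) 1; have k2 := key (e + l) (-1).
rewrite ler_norml; apply/andP; split.
- have : forall x, s <= x <= t -> 0 <= 1 * df x + (e - l) * dg x.
    by move=> x /bnd; rewrite ler_norml => /andP[]; lra.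
  by move=> /k1; lra.
- have : forall x, s <= x <= t -> 0 <= -1 * df x + (e + l) * dg x.
    by move=> x /bnd; rewrite ler_norml => /andP[]; lra.
  by move=> /k2; lra.
Unshelve. all: end_near. Qed.

Lemma lhopital_pinfty_oo (R : realType) (f df g dg : R -> R) (l : R) :
  (\forall t \near +oo, is_derive (t : R) 1 f (df t)) ->
  (\forall t \near +oo, is_derive (t : R) 1 g (dg t)) ->
  (\forall t \near +oo, 0 < dg t) ->
  df t / dg t @[t --> +oo] --> l -> g t @[t --> +oo] --> +oo ->
  f t / g t @[t --> +oo] --> l.
Proof.
move=> fdf gdg dg0 fgl goo; apply/cvgrPdist_le => e e0.
have e20 : 0 < e / 2 by rewrite divr_gt0.
have [T HT] := lhopital_increments fdf gdg dg0 fgl e20.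
near=> t.
have Tt : T <= t by near: t; apply: nbhs_pinfty_ge; exact: num_real.
have gt0 : 0 < g t by near: t; move/cvgryPgt : goo; exact.
have gT : - g T <= g t by near: t; move/cvgryPge : goo; exact.
(* Half of [e] pays for the increments; once [g t] is this large, the other half absorbs everything
   that depends on the base point [T]. *)
have : (`|f T - l * g T| + e / 2 * `|g T|) / (e / 2) <= g t.
  by near: t; move/cvgryPge : goo; exact.
rewrite ler_pdivrMr// => big.
have := HT T t (lexx _) Tt; rewrite ler_norml => /andP[h1 h2].
suff : `|l * g t - f t| <= e * g t.
  have -> : l * g t - f t = (l - f t / g t) * g t.
    by rewrite mulrBl divfK ?gt_eqF.
  by rewrite normrM (gtr0_norm gt0) ler_pM2r.
have := ler_norm (f T - l * g T); have := ler_norm (- (f T - l * g T)); rewrite normrN => ? ?.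
have := ler_norm (g T); have := ler_norm (- g T); rewrite normrN => ? ?.
have : 0 <= e / 2 * (`|g T| - g T) by rewrite mulr_ge0 ?(ltW e20)// subr_ge0.
have : 0 <= e / 2 * (`|g T| + g T) by rewrite mulr_ge0 ?(ltW e20)//; lra.
by move=> ? ?; rewrite ler_norml; apply/andP; split; lra.
Unshelve. all: end_near. Qed.

(** Letting [t] tend to infinity in the increment estimate bounds [l * g s - f s] by [e * - g s]. As
    [g] increases to 0 it is negative, whence the sign in the last hypothesis. *)
Lemma lhopital_pinfty_0 (R : realType) (f df g dg : R -> R) (l : R) :
  (\forall t \near +oo, is_derive (t : R) 1 f (df t)) ->
  (\forall t \near +oo, is_derive (t : R) 1 g (dg t)) ->
  (\forall t \near +oo, 0 < dg t) ->
  df t / dg t @[t --> +oo] --> l ->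
  f t @[t --> +oo] --> 0 -> g t @[t --> +oo] --> 0 ->
  (\forall t \near +oo, g t < 0) ->
  f t / g t @[t --> +oo] --> l.
Proof.
move=> fdf gdg dg0 fgl f0 g0 gn; apply/cvgrPdist_le => e e0.
have [T HT] := lhopital_increments fdf gdg dg0 fgl e0.
near=> s.
have Ts : T <= s by near: s; apply: nbhs_pinfty_ge; exact: num_real.
have gs : g s < 0 by near: s.
have : `|- f s + l * g s| <= e * - g s.
  have lf : `|f t - f s - l * (g t - g s)| @[t --> +oo] --> `|- f s + l * g s|.
    have -> : - f s + l * g s = 0 - f s - l * (0 - g s) by ring.
    apply: cvg_norm; apply: cvgB; first by apply: cvgB => //; exact: cvg_cst.
    by apply: cvgMl_tmp; apply: cvgB => //; exact: cvg_cst.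
  have lg : e * (g t - g s) @[t --> +oo] --> e * - g s.
    have -> : e * - g s = e * (0 - g s) by rewrite sub0r.
    by apply: cvgMl_tmp; apply: cvgB => //; exact: cvg_cst.
  apply: (ler_cvg_to lf lg); by near=> t; exact: HT.
have ngs : 0 < - g s by rewrite oppr_gt0.
have -> : - f s + l * g s = - ((l - f s / g s) * - g s).
  by rewrite mulrN opprK mulrBl divfK ?lt_eqF//; ring.
by rewrite normrN normrM (gtr0_norm ngs) ler_pM2r.
Unshelve. all: end_near. Qed.

(** * Karamata theory for continuous functions *)

(* Karamata's uniform convergence theorem in additive form: by Baire, for some
   threshold the increments are small simultaneously for all u in an interval;
   differences of such increments cover a neighbourhood of 0. *)
Lemma increments_cvg0_uniform (R : realType) (h : R -> R) (X : R) :
  (forall x, X <= x -> {for x, continuous h}) ->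
  (forall u : R, 0 <= u -> h (x + u) - h x @[x --> +oo] --> 0) ->
  forall e M : R, 0 < e -> exists T : R, forall x u, T <= x -> 0 <= u <= M ->
    `|h (x + u) - h x| <= e.
Proof.
move=> ch hu e M e0.
have e30 : 0 < e / 3 by rewrite divr_gt0.
(* Baire's theorem works on the whole line, so the shift enters through its absolute value. A point
   in every [F n] would have increments that do not tend to 0, so some [F n] is not dense and misses
   an open set [V]. *)
pose F (n : nat) := [set u : R | exists2 x : R, X + n%:R <= x &
  e / 3 < `|h (x + `|u|) - h x|].
have oF n : open (F n).
  have -> : F n = \bigcup_(x in [set x | X + n%:R <= x])
      (fun u => `|h (x + `|u|) - h x|) @^-1` [set y | e / 3 < y].
    by apply/seteqP; split=> u /= [x xn hx]; exists x.
  apply: bigcup_open => x /= Xnx; apply: open_comp; last exact: open_gt.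
  move=> u _; apply: cvg_norm; apply: cvgB; last exact: cvg_cst.
  apply: (@continuous_comp _ _ _ (fun u => x + `|u|) h); last first.
    by apply: ch; rewrite (le_trans (le_trans _ Xnx))// lerDl.
  by apply: cvgD; [exact: cvg_cst|exact: norm_continuous].
have [n nd] : exists n, ~ dense (F n).
  apply: contrapT => /forallNP nd.
  have dF : forall i, open (F i) /\ dense (F i).
    by move=> i; split => //; exact: contrapT (nd i).
  have [u [_ Fu]] := @Baire R R F dF setT (ex_intro _ 0 I) openT.
  have /cvgrPdist_le /(_ _ e30) := hu `|u| (normr_ge0 u).
  move=> /(near_pinftyP X)[T XT HT].
  have [x lx ex] := Fu (Num.truncn (T - X)).+1 I.
  have Tx : T <= x.
    rewrite (le_trans _ lx)// -lerBlDl ltW// truncnS_gt//.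
  by have := HT x Tx; rewrite sub0r normrN leNgt ex.
move: nd => /existsNP[V]; rewrite not_implyE => -[[c Vc]].
rewrite not_implyE => -[oV /set0P/negP/negPn/eqP VF].
have /nbhs_ballP[eta /= eta0 cV] := open_nbhs_nbhs (conj oV Vc).
(* From [c], moving away from 0 by [v] stays in [V] and gives a point whose absolute value is
   exactly that of [c] plus [v]. *)
have bd x v : X + n%:R <= x -> 0 <= v < eta ->
    `|h (x + (`|c| + v)) - h x| <= e / 3.
  move=> Xx /andP[v0 veta]; rewrite leNgt; apply/negP => H.
  pose u := if 0 <= c then c + v else c - v.
  suff : (V `&` F n) u by rewrite VF.
  have nu : `|u| = `|c| + v.
    rewrite /u; case: (leP 0 c) => c0; first by rewrite !ger0_norm// addr_ge0.
    by rewrite !ltr0_norm// ?opprB ?subr_lt0 1?addrC// (lt_le_trans c0).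
  split; last by exists x => //; rewrite nu.
  apply: cV; rewrite /ball/= /u; case: (leP 0 c) => c0.
    by rewrite opprD addrA subrr sub0r normrN ger0_norm.
  by rewrite opprB addrC subrK ger0_norm.
have loc x v : X + n%:R + `|c| <= x -> 0 <= v < eta ->
    `|h (x + v) - h x| <= e / 3 * 2.
  move=> Xx v0.
  have Xx' : X + n%:R <= x - `|c| by rewrite lerBrDr.
  have h1 := bd _ _ Xx' v0.
  have h2 := bd _ 0 Xx' (introT andP (conj (lexx _) eta0)).
  rewrite addr0 subrK in h2; rewrite addrA subrK in h1.
  have -> : h (x + v) - h x = (h (x + v) - h (x - `|c|)) - (h x - h (x - `|c|)).
    by ring.
  by rewrite (le_trans (ler_normB _ _))//; lra.
pose d := eta / 2.
have d0 : 0 < d by rewrite divr_gt0.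
have deta : d < eta by rewrite /d; lra.
(* The error does not accumulate with [K]: the multiple [K%:R * d] is a fixed shift, where pointwise
   convergence costs [e / 3], and what remains is a shift shorter than [eta], which costs
   [e / 3 * 2] by [loc]. *)
have step (K : nat) : exists T, forall x u, T <= x -> 0 <= u <= K%:R * d ->
    `|h (x + u) - h x| <= e.
  elim: K => [|K [T HT]].
    exists 0 => x u _; rewrite mul0r => u0; have -> : u = 0 by lra.
    by rewrite addr0 subrr normr0 ltW.
  have Kd0 : 0 <= K%:R * d by rewrite mulr_ge0// ltW.
  have /cvgrPdist_le /(_ _ e30) /(near_pinftyP (X + n%:R + `|c|))[T' XT' HT'] := hu _ Kd0.
  exists (Num.max T T') => x u; rewrite ge_max => /andP[Tx T'x] /andP[u0].
  rewrite -natr1 mulrDl mul1r => uK.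
  have [uKd|uKd] := leP u (K%:R * d); first by apply: HT => //; rewrite u0.
  have h1 := HT' x T'x; rewrite sub0r normrN in h1.
  have h2 : `|h (x + K%:R * d + (u - K%:R * d)) - h (x + K%:R * d)| <= e / 3 * 2.
    apply: loc; last by lra.
    by rewrite (le_trans XT')// (le_trans T'x)// lerDl.
  have e1 : x + K%:R * d + (u - K%:R * d) = x + u by ring.
  rewrite e1 in h2.
  have -> : h (x + u) - h x = (h (x + u) - h (x + K%:R * d)) + (h (x + K%:R * d) - h x).
    by ring.
  by rewrite (le_trans (ler_normD _ _))//; lra.
have [T HT] := step (Num.truncn (M / d)).+1.
exists T => x u Tx /andP[u0 uM]; apply: HT => //; rewrite u0 (le_trans uM)//.
by rewrite -ler_pdivrMr// ltW// truncnS_gt.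
Qed.

Lemma cvg_mul_pinfty (R : realType) (l : R) : 0 < l -> l * t @[t --> +oo] --> +oo.
Proof.
move=> l0; apply/cvgryPge => A; near=> t.
by rewrite -ler_pdivrMl//.
Unshelve. all: end_near. Qed.

Lemma near_mul_pinfty (R : realType) (l : R) (P : R -> Prop) : 0 < l ->
  (\forall t \near +oo, P t) -> \forall t \near +oo, P (l * t).
Proof. by move=> l0 nP; exact: (cvg_mul_pinfty l0 nP). Qed.

Lemma cvg_eq_near (R : realType) (f g : R -> R) (l : R) :
  (\forall t \near +oo, f t = g t) -> g t @[t --> +oo] --> l ->
  f t @[t --> +oo] --> l.
Proof.
by move=> fg; apply: cvg_trans; apply: near_eq_cvg; apply: filterS fg => t ->.
Qed.

Lemma cvg_ln (R : realType) (f : R -> R) (l : R) : 0 < l ->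
  f t @[t --> +oo] --> l -> ln (f t) @[t --> +oo] --> ln l.
Proof. by move=> l0; exact: (continuous_cvg _ (continuous_ln l0)). Qed.

Lemma cvg_powR (R : realType) (f : R -> R) (l b : R) : 0 < l ->
  f t @[t --> +oo] --> l -> f t `^ b @[t --> +oo] --> l `^ b.
Proof.
move=> l0.
exact: (continuous_cvg _ (is_derive_continuous (is_derive1_powR b l0))).
Qed.

(** The limit condition of [RV] alone. It is insensitive to sign, so it also applies to a negative
    primitive that increases to 0; positivity and measurability are restored in
    [RV_of_continuous]. *)
Definition RVlim {R : realType} (theta : R) (f : R -> R) :=
  forall l : R, 0 < l -> f (l * t) / f t @[t --> +oo] --> l `^ theta.

(** In logarithmic coordinates [ln (f (expR x)) - theta * x] has increments tending to 0. Their
    uniform smallness over shifts in [[0, ln l]], with bound [ln (1 + e)], compares [f] on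
    [[t, l * t]] with the pure power that agrees with it at [t]. *)
Lemma RVlim_uniform (R : realType) (f : R -> R) (theta l e : R) :
  (\forall t \near +oo, 0 < f t) -> (\forall t \near +oo, {for t, continuous f}) ->
  RVlim theta f -> 0 < e ->
  \forall t \near +oo, forall x, t <= x <= l * t ->
    (1 + e)^-1 * (f t / t `^ theta * x `^ theta) <= f x <=
    (1 + e) * (f t / t `^ theta * x `^ theta).
Proof.
move=> f0 cf ff e0.
have [T T1 fT] : exists2 T, 1 <= T & forall t, T <= t -> 0 < f t /\ {for t, continuous f}.
  by apply: near_pinftyP; exact: filterI.
have T0 : 0 < T by exact: lt_le_trans T1.
pose h x := ln (f (expR x)) - theta * x.
have eT x : ln T <= x -> T <= expR x.
  by move=> Tx; rewrite -(lnK T0) ler_expR.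
have ch x : ln T <= x -> {for x, continuous h}.
  move=> /eT /fT[fx cfx]; apply: cvgB.
    apply: (@continuous_comp _ _ _ (f \o expR) (@ln R)); last exact: continuous_ln.
    by apply: continuous_comp; [exact: continuous_expR|].
  by apply: cvgM; [exact: cvg_cst|exact: cvg_id].
have e10 : 0 < 1 + e by rewrite addr_gt0.
have hu (u : R) : 0 <= u -> h (x + u) - h x @[x --> +oo] --> 0.
  move=> u0.
  have lim : ln (f (expR u * t) / f t) - theta * u @[t --> +oo] --> 0.
    have -> : 0 = ln (expR u `^ theta) - theta * u by rewrite ln_powR expRK subrr.
    apply: cvgB; last exact: cvg_cst.
    by apply: cvg_ln; [exact: powR_gt0 (expR_gt0 _)|exact: ff (expR_gt0 _)].
  have ey : (expR x : R) @[x --> +oo] --> +oo.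
    apply/cvgryPge => A; near=> x; rewrite (le_trans _ (expR_ge1Dx x))//.
    by rewrite -lerBlDl.
  apply: cvg_eq_near (cvg_comp _ _ ey lim); near=> x => /=.
  have xT : ln T <= x by [].
  have [fx _] := fT _ (eT _ xT).
  have xuT : ln T <= x + u by rewrite (le_trans xT)// lerDl.
  have [fxu _] := fT _ (eT _ xuT).
  rewrite /h -expRD (addrC u x) ln_div ?posrE//; ring.
have le1e : 0 < ln (1 + e) by rewrite ln_gt0// ltrDl.
have [X HX] := increments_cvg0_uniform ch hu (ln l) le1e.
near=> t => x /andP[tx xlt].
have Tt : T <= t by [].
have t0 : 0 < t by exact: lt_le_trans Tt.
have x0 : 0 < x by exact: lt_le_trans tx.
have [ft _] := fT _ Tt; have [fx _] := fT _ (le_trans Tt tx).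
have l0 : 0 < l by rewrite -(pmulr_lgt0 _ t0) (lt_le_trans x0).
have Xt : X <= ln t by rewrite -ler_expR lnK.
have := HX (ln t) (ln x - ln t) Xt.
have -> : ln t + (ln x - ln t) = ln x by ring.
rewrite subr_ge0 ler_ln// tx /= lerBlDr -lnM ?posrE// ler_ln ?posrE ?mulr_gt0//.
rewrite xlt /h !lnK ?posrE// => /(_ isT).
have txt : f t / t `^ theta * x `^ theta = expR (ln (f t) - theta * ln t + theta * ln x).
  by rewrite expRD expRB lnK ?posrE// /powR !gt_eqF.
rewrite ler_norml => /andP[h1 h2]; apply/andP; split.
- rewrite -[leRHS]lnK ?posrE// txt -[(1 + e)^-1]lnK ?posrE ?invr_gt0// -expRD ler_expR.
  by rewrite lnV ?posrE//; lra.
- rewrite -[leLHS]lnK ?posrE// txt -[1 + e]lnK ?posrE// -expRD ler_expR.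
  by lra.
Unshelve. all: end_near. Qed.

Lemma powRD_gt0 (R : realType) (x r s : R) : 0 < x -> x `^ (r + s) = x `^ r * x `^ s.
Proof. by move=> x0; rewrite powRD// (gt_eqF x0) implybT. Qed.

Lemma is_derive_scale (R : realType) (f : R -> R) (c t d : R) :
  is_derive t 1 f d -> is_derive t 1 (fun x => c * f x) (c * d).
Proof. exact: is_deriveZ. Qed.

Lemma is_derive_prod (R : realType) (f g : R -> R) (t df dg : R) :
  is_derive t 1 f df -> is_derive t 1 g dg ->
  is_derive t 1 (fun x => f x * g x) (df * g t + f t * dg).
Proof. by move=> fd gd; rewrite addrC [df * _]mulrC; exact: is_deriveM. Qed.

Lemma is_derive_mull (R : realType) (f : R -> R) (l t d : R) :
  is_derive (l * t) 1 f d -> is_derive t 1 (fun x => f (l * x)) (l * d).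
Proof.
move=> fd; rewrite mulrC.
have dl : is_derive t 1 (fun x : R => l * x) (l * 1).
  by apply: is_derive_scale; exact: is_derive_id.
rewrite mulr1 in dl; exact: (is_derive1_comp fd dl).
Qed.

(** On [[t, l * t]] the derivative of [F] is within a factor [1 + d] of that of a multiple of [H],
    and the increments inherit the comparison. Leaving the primitive [H] of the power open treats
    the logarithm (index -1) and the other powers at once. *)
Lemma karamata_increment (R : realType) (F f H : R -> R) (theta l K : R) :
  (\forall t \near +oo, is_derive (t : R) 1 F (f t)) ->
  (\forall t \near +oo, 0 < f t) -> (\forall t \near +oo, {for t, continuous f}) ->
  RVlim theta f -> 1 < l ->
  (forall t : R, 0 < t -> is_derive t 1 H (t `^ theta)) ->
  (forall t : R, 0 < t -> H (l * t) - H t = t `^ theta * t * K) ->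
  (F (l * t) - F t) / (t * f t) @[t --> +oo] --> K.
Proof.
move=> Ff f0 cf ff l1 HH HK; have l0 : 0 < l by exact: lt_trans l1.
have tl t : 0 < t -> t <= l * t by move=> t0; rewrite ler_peMl// ltW.
have K0 : 0 <= K.
  have := HK 1 ltr01; rewrite powR1 !mul1r => <-; rewrite subr_ge0.
  apply: (le_of_derive_ge0 (df := fun x => x `^ theta)) => [|x /andP[x1 _]|x _].
  - by rewrite mulr1 ltW.
  - by apply: HH; exact: lt_le_trans x1.
  - exact: powR_ge0.
apply/cvgrPdist_le => e e0.
(* Dividing by [K + 1] instead of [K] gives [d * K <= e] from [0 <= K] alone. *)
have K10 : 0 < K + 1 by rewrite ltr_wpDl.
have d0 : 0 < e / (K + 1) by rewrite divr_gt0.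
set d := e / (K + 1) in d0.
have dK : d * K <= e by rewrite /d mulrAC ler_pdivrMr// ler_pM2l// lerDl.
have [T _ HT] : exists2 T : R, 0 <= T & forall t : R, T <= t -> is_derive t 1 F (f t) /\ 0 < f t.
  by apply: near_pinftyP; exact: filterI.
have U := @RVlim_uniform R f theta l d f0 cf ff d0.
near=> t.
have t0 : 0 < t by [].
have Tt : T <= t by [].
have ft0 : 0 < f t by near: t.
have tft : 0 < t * f t by exact: mulr_gt0.
have tt : 0 < t `^ theta by exact: powR_gt0.
have dom (x : R) : t <= x <= l * t ->
    [/\ is_derive x 1 F (f x), is_derive x 1 H (x `^ theta) & 
    (1 + d)^-1 * (f t / t `^ theta * x `^ theta) <= f x <=
    (1 + d) * (f t / t `^ theta * x `^ theta)].
  move=> txl; have /andP[tx _] := txl.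
  split; [exact: (HT x (le_trans Tt tx)).1|apply: HH; exact: lt_le_trans tx|].
  by move: x txl {tx}; near: t; exact: U.
have inc (b c : R) :
    (forall x, t <= x <= l * t -> 0 <= b * f x + c * (f t / t `^ theta * x `^ theta)) ->
    0 <= b * (F (l * t) - F t) + c * (t * f t * K).
  move=> h.
  have -> : t * f t * K = f t / t `^ theta * (H (l * t) - H t).
    by rewrite HK//; field; rewrite gt_eqF.
  set A := f t / _ in h *.
  rewrite (_ : _ + _ = (b * F (l * t) + c * (A * H (l * t))) - (b * F t + c * (A * H t))).
    rewrite subr_ge0.
    apply: (@le_of_derive_ge0 R (fun x => b * F x + c * (A * H x))
       (fun x => b * f x + c * (A * x `^ theta)) t (l * t) (tl _ t0)) => // x /dom[Fx Hx _].
    by apply: is_deriveD; do ?apply: is_derive_scale.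
  by ring.
have up : F (l * t) - F t <= (1 + d) * (t * f t * K).
  rewrite -subr_ge0 addrC -mulN1r; apply: inc => x.
  by move=> /dom[_ _ /andP[_]]; rewrite -subr_ge0; lra.
have lo : (1 + d)^-1 * (t * f t * K) <= F (l * t) - F t.
  rewrite -subr_ge0 -mulNr -[X in 0 <= X + _]mul1r; apply: inc => x.
  by move=> /dom[_ _ /andP[+ _]]; rewrite -subr_ge0; lra.
(* Since [(1 - d) * (1 + d) <= 1], the lower factor may be replaced by [1 - d], and both errors
   become [d * K]. *)
have lo2 : (1 - d) * (t * f t * K) <= F (l * t) - F t.
  apply: le_trans lo; rewrite ler_wpM2r ?mulr_ge0// ?(ltW t0) ?(ltW ft0)//.
  have d10 : 0 < 1 + d by rewrite addr_gt0.
  rewrite -[(1 + d)^-1]mul1r ler_pdivlMr// -subr_ge0.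
  have -> : 1 - (1 - d) * (1 + d) = d ^+ 2 by ring.
  exact: sqr_ge0.
rewrite distrC ler_norml; apply/andP; split.
- rewrite lerBrDr ler_pdivlMr// (le_trans _ lo2)//.
  have -> : (1 - d) * (t * f t * K) = (K - d * K) * (t * f t) by ring.
  by rewrite ler_pM2r//; lra.
- rewrite lerBlDr ler_pdivrMr// (le_trans up)//.
  have -> : (1 + d) * (t * f t * K) = (K + d * K) * (t * f t) by ring.
  by rewrite ler_pM2r//; lra.
Unshelve. all: end_near. Qed.

Lemma karamata_increment_log (R : realType) (F f : R -> R) (l : R) :
  (\forall t \near +oo, is_derive (t : R) 1 F (f t)) ->
  (\forall t \near +oo, 0 < f t) -> (\forall t \near +oo, {for t, continuous f}) ->
  RVlim (-1) f -> 1 < l ->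
  (F (l * t) - F t) / (t * f t) @[t --> +oo] --> ln l.
Proof.
move=> Ff f0 cf ff l1; have l0 : 0 < l by exact: lt_trans l1.
apply: (karamata_increment (H := @ln R) Ff f0 cf ff l1) => t t0.
- by rewrite powR_inv1 ?(ltW t0)//; exact: is_derive1_ln.
- by rewrite powR_inv1 ?(ltW t0)// mulVf ?gt_eqF// mul1r lnM// addrK.
Qed.

Lemma karamata_increment_pow (R : realType) (F f : R -> R) (theta l : R) :
  (\forall t \near +oo, is_derive (t : R) 1 F (f t)) ->
  (\forall t \near +oo, 0 < f t) -> (\forall t \near +oo, {for t, continuous f}) ->
  RVlim theta f -> theta + 1 != 0 -> 1 < l ->
  (F (l * t) - F t) / (t * f t) @[t --> +oo] -->
    (l `^ (theta + 1) - 1) / (theta + 1).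
Proof.
move=> Ff f0 cf ff th l1; have l0 : 0 < l by exact: lt_trans l1.
apply: (karamata_increment (H := fun t => (theta + 1)^-1 * t `^ (theta + 1))
  Ff f0 cf ff l1) => t t0.
- have -> : t `^ theta = (theta + 1)^-1 * ((theta + 1) * t `^ (theta + 1 - 1)).
    by rewrite mulrA mulVf// mul1r addrK.
  exact/is_derive_scale/is_derive1_powR.
- rewrite powRM ?(ltW l0) ?(ltW t0)//.
  have -> : t `^ theta * t = t `^ (theta + 1).
    by rewrite powRD_gt0// powRr1// ltW.
  by field.
Qed.

(** The derivatives of [F (l * t)] and [F t] have quotient [l * f (l * t) / f t], so l'Hopital's
    rule alone raises the index by one; no uniformity is involved. *)
Lemma RVlim_primitive_oo (R : realType) (F f : R -> R) (theta : R) :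
  (\forall t \near +oo, is_derive (t : R) 1 F (f t)) ->
  (\forall t \near +oo, 0 < f t) -> RVlim theta f ->
  F t @[t --> +oo] --> +oo -> RVlim (theta + 1) F.
Proof.
move=> Ff f0 ff Foo l l0.
have lf : l * f (l * t) / f t @[t --> +oo] --> l `^ (theta + 1).
  rewrite addrC powRD_gt0// powRr1 ?(ltW l0)//.
  under eq_fun do rewrite -mulrA.
  by apply: cvgMl_tmp; exact: ff.
apply: (lhopital_pinfty_oo _ Ff f0 lf Foo).
by apply: filterS (near_mul_pinfty l0 Ff) => t; exact: is_derive_mull.
Qed.

Lemma RVlim_primitive_0 (R : realType) (F f : R -> R) (theta : R) :
  (\forall t \near +oo, is_derive (t : R) 1 F (f t)) ->
  (\forall t \near +oo, 0 < f t) -> RVlim theta f ->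
  F t @[t --> +oo] --> 0 -> (\forall t \near +oo, F t < 0) -> RVlim (theta + 1) F.
Proof.
move=> Ff f0 ff Foo Fn l l0.
have lf : l * f (l * t) / f t @[t --> +oo] --> l `^ (theta + 1).
  rewrite addrC powRD_gt0// powRr1 ?(ltW l0)//.
  under eq_fun do rewrite -mulrA.
  by apply: cvgMl_tmp; exact: ff.
have F0 : F (l * t) @[t --> +oo] --> 0.
  exact: (cvg_comp _ _ (cvg_mul_pinfty l0) Foo).
apply: (lhopital_pinfty_0 _ Ff f0 lf F0 Foo Fn).
by apply: filterS (near_mul_pinfty l0 Ff) => t; exact: is_derive_mull.
Qed.

(** The increment [F (2 * t) - F t] is known on two scales: relative to [t * f t] by uniform regular
    variation of [f], and relative to [F t] because [F] has index [theta + 1]. Dividing one limit by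
    the other gives the claim; the factor 2 is arbitrary. *)
Lemma karamata_primitive_oo (R : realType) (F f : R -> R) (theta : R) :
  (\forall t \near +oo, is_derive (t : R) 1 F (f t)) ->
  (\forall t \near +oo, 0 < f t) -> (\forall t \near +oo, {for t, continuous f}) ->
  RVlim theta f -> -1 < theta -> F t @[t --> +oo] --> +oo ->
  F t / (t * f t) @[t --> +oo] --> (theta + 1)^-1.
Proof.
move=> Ff f0 cf ff th Foo.
have th0 : 0 < theta + 1 by rewrite -ltrBlDr sub0r.
have two1 : 1 < 2 :> R by rewrite ltr1n.
have k1 : 1 < 2 `^ (theta + 1) :> R.
  by rewrite -[ltLHS](powRr0 2) /powR gt_eqF// ltr_expR ltr_pM2r// ln_gt0.
set k := 2 `^ (theta + 1) in k1.
have FR := RVlim_primitive_oo Ff f0 ff Foo (ltr0n R 2).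
have FI := karamata_increment_pow Ff f0 cf ff (lt0r_neq0 th0) two1.
have FF : F (2 * t) / F t - 1 @[t --> +oo] --> k - 1.
  by apply: cvgB => //; exact: cvg_cst.
have k10 : k - 1 != 0 by rewrite subr_eq0 gt_eqF.
have -> : (theta + 1)^-1 = (k - 1) / (theta + 1) / (k - 1).
  by field; rewrite k10 gt_eqF.
apply: cvg_eq_near (cvgM FI (cvgV k10 FF)); near=> t => /=.
have Ft : 0 < F t by near: t; move/cvgryPgt : Foo; exact.
have t0 : 0 < t by [].
have ft : 0 < f t by near: t.
have F2 : F (2 * t) / F t - 1 != 0.
  apply: lt0r_neq0; near: t; apply: cvgr_gt FF _ _; rewrite subr_gt0//.
have F2' : F (2 * t) - F t != 0.
  by apply: contra_neq F2 => /eqP; rewrite subr_eq0 => /eqP ->; rewrite divff ?gt_eqF// subrr.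
by field; rewrite mulN1r F2' !gt_eqF.
Unshelve. all: end_near. Qed.

(** At index -1 the primitive [F] is slowly varying, so [F (2 * t) - F t] is negligible against
    [F t], while it is asymptotic to [ln 2 * (t * f t)]. *)
Lemma karamata_boundary_0 (R : realType) (F f : R -> R) :
  (\forall t \near +oo, is_derive (t : R) 1 F (f t)) ->
  (\forall t \near +oo, 0 < f t) -> (\forall t \near +oo, {for t, continuous f}) ->
  RVlim (-1) f -> F t @[t --> +oo] --> 0 -> (\forall t \near +oo, F t < 0) ->
  t * f t / F t @[t --> +oo] --> 0.
Proof.
move=> Ff f0 cf ff F0 Fn.
have two1 : 1 < 2 :> R by rewrite ltr1n.
have FR := RVlim_primitive_0 Ff f0 ff F0 Fn (ltr0n R 2).
have FI := karamata_increment_log Ff f0 cf ff two1.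
rewrite addNr powRr0 in FR.
have FF : F (2 * t) / F t - 1 @[t --> +oo] --> (1 - 1 : R).
  by apply: cvgB => //; exact: cvg_cst.
rewrite subrr in FF.
have l2 : 0 < ln 2 :> R by rewrite ln_gt0.
have -> : 0 = 0 * (ln 2)^-1 :> R by rewrite mul0r.
apply: cvg_eq_near (cvgM FF (cvgV (lt0r_neq0 l2) FI)); near=> t => /=.
have Ft : F t < 0 by near: t.
have t0 : 0 < t by [].
have ft : 0 < f t by near: t.
have F2 : (F (2 * t) - F t) / (t * f t) != 0.
  by apply: lt0r_neq0; near: t; exact: (cvgr_gt _ FI).
have F2' : F (2 * t) - F t != 0 by apply: contra_neq F2 => ->; rewrite mul0r.
by field; rewrite ?mulN1r ?F2' ?(lt_eqF Ft) ?(gt_eqF t0) ?(gt_eqF ft).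
Unshelve. all: end_near. Qed.

(** * Integrals of continuous functions over half-lines *)

Section integrals_of_continuous_functions.
Context {R : realType}.
Notation mu := (@lebesgue_measure R).
Implicit Types (f g F : R -> R) (a s t : R).

Lemma within_itvcy_continuous f a : {within `[a, +oo[, continuous f} ->
  forall t, a < t -> {for t, continuous f}.
Proof.
by move=> /continuous_within_itvcyP[cf _] t at_; apply: cf; rewrite in_itv/= andbT.
Qed.

Lemma within_itvcy_measurable f a : {within `[a, +oo[, continuous f} ->
  measurable_fun `[a, +oo[ f.
Proof. by move=> cf; exact: subspace_continuous_measurable_fun. Qed.

Lemma continuous_within_itvcy f a : (forall t, a <= t -> {for t, continuous f}) ->
  {within `[a, +oo[, continuous f}.
Proof.
move=> cf; apply: continuous_in_subspaceT => x.
by rewrite inE/= in_itv/= andbT => /cf.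
Qed.

Lemma within_itvcyS f a s : a <= s -> {within `[a, +oo[, continuous f} ->
  {within `[s, +oo[, continuous f}.
Proof. by move=> as_; apply: continuous_subspaceW; apply: subset_itvr; rewrite bnd_simp. Qed.

Lemma within_itvcy_integrable f a t : {within `[a, +oo[, continuous f} ->
  mu.-integrable `[a, t] (fun x => (f x)%:E).
Proof.
move=> cf; apply: continuous_compact_integrable; first exact: segment_compact.
by apply: continuous_subspaceW cf; exact: subset_itvl.
Qed.

Lemma is_derive_Rintegral f a t : {within `[a, +oo[, continuous f} -> a < t ->
  is_derive t 1 (fun x => \int[mu]_(s in `[a, x]) f s) (f t).
Proof.
move=> cf at_.
have t1 : t < t + 1 by rewrite ltrDl.
have [dF F'] := continuous_FTC1_closed t1 (within_itvcy_integrable (t + 1) cf) at_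
  (within_itvcy_continuous cf at_).
by apply: DeriveDef => //; rewrite -derive1E.
Qed.

Lemma Rintegral_FTC2 f F s t : s <= t -> {within `[s, +oo[, continuous f} ->
  (forall x, s <= x -> is_derive x 1 F (f x)) ->
  \int[mu]_(x in `[s, t]) f x = F t - F s.
Proof.
rewrite le_eqVlt => /predU1P[<- _ _|st cf Ff].
  by rewrite set_itv1 Rintegral_set1 subrr.
have cF x : s <= x -> {for x, continuous F}.
  by move=> sx; exact: is_derive_continuous (Ff x sx).
rewrite /Rintegral (@continuous_FTC2 R f F s t)//.
- by apply: continuous_subspaceW cf; exact: subset_itvl.
- split.
  + move=> x; rewrite in_itv/= => /andP[/ltW sx _].
    by have [] := Ff x sx.
  + by apply: cvg_at_right_filter; exact: cF.
  + by apply: cvg_at_left_filter; apply: cF; exact: ltW.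
- move=> x; rewrite in_itv/= => /andP[/ltW sx _].
  by rewrite derive1E; have [_ ->] := Ff x sx.
Qed.

(** At [s] only continuity from the right is asked, so that [s] may be the lower limit of an
    integral [F], a point where no two-sided derivative of [F] is at hand. *)
Lemma ge0_integral_itvcy f F s l : {within `[s, +oo[, continuous f} ->
  (forall x, s <= x -> 0 <= f x) ->
  (forall x, s < x -> is_derive x 1 F (f x)) -> F x @[x --> s^'+] --> F s ->
  F x @[x --> +oo] --> l ->
  mu.-integrable `[s, +oo[ (fun x => (f x)%:E) /\
  (\int[mu]_(x in `[s, +oo[) (f x)%:E = (l - F s)%:E)%E.
Proof.
move=> cf f0 Ff Fs Fl.
have I : (\int[mu]_(x in `[s, +oo[) (f x)%:E = (l - F s)%:E)%E.
  rewrite (ge0_continuous_FTC2y f0 cf Fl)// => x.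
    by move=> /Ff[].
  by rewrite in_itv/= andbT => /Ff[_ <-]; rewrite derive1E.
split=> //; apply/integrableP; split.
  by apply/measurable_EFinP; exact: within_itvcy_measurable.
rewrite (_ : (\int[mu]_(x in _) _)%E = (l - F s)%:E) ?ltry// -I.
apply: eq_integral => x; rewrite inE/= in_itv/= andbT => /f0 fx.
by rewrite /= ger0_norm.
Qed.

Lemma integrable_eq_in (A : set R) f g : measurable A -> (forall x, A x -> f x = g x) ->
  mu.-integrable A (fun x => (f x)%:E) -> mu.-integrable A (fun x => (g x)%:E).
Proof. by move=> mA fg; apply: eq_integrable => // x /set_mem /fg ->. Qed.

Lemma integrable_setU (A B : set R) (f : R -> \bar R) : measurable A -> measurable B ->
  [disjoint A & B] -> mu.-integrable A f -> mu.-integrable B f ->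
  mu.-integrable (A `|` B) f.
Proof.
move=> mA mB AB /integrableP[mfA fA] /integrableP[mfB fB]; apply/integrableP.
have mf : measurable_fun (A `|` B) f by apply/measurable_funU.
split=> //; rewrite ge0_integral_setU//; first exact: lte_add_pinfty.
exact: measurableT_comp.
Qed.

Lemma nondecreasing_bounded_cvg (F : R -> R) a C :
  (forall s t, a <= s -> s <= t -> F s <= F t) -> (forall t, a <= t -> F t <= C) ->
  exists l : R, F t @[t --> +oo] --> l.
Proof.
(* Freezing [F] to the left of [a] makes [g] monotone and bounded above on the whole line. *)
move=> Fle FC; pose g t := F (Num.max a t).
have gle : {homo g : x y / x <= y}.
  move=> x y xy; apply: Fle; first by rewrite le_max lexx.
  by rewrite ge_max !le_max lexx xy orbT.
have gb : has_ubound (range g).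
  by exists C => _ [t _ <-]; apply: FC; rewrite le_max lexx.
exists (sup (range g)); apply: cvg_eq_near (nondecreasing_cvgr gle gb).
by near=> t; rewrite /g (max_idPr _).
Unshelve. all: end_near. Qed.

Section nonnegative_integrand.
Variables (f : R -> R) (a : R).
Hypotheses (cf : {within `[a, +oo[, continuous f}) (f0 : forall t, a <= t -> 0 <= f t).
Let F t := \int[mu]_(s in `[a, t]) f s.

Lemma Rintegral_nondecreasing s t : a <= s -> s <= t -> F s <= F t.
Proof.
move=> as_ st; have at_ := le_trans as_ st.
have := @Rintegral_itvB R f (BLeft a) (BRight t) s (within_itvcy_integrable t cf).
rewrite !bnd_simp => /(_ as_ st) e; rewrite -subr_ge0 e; apply: Rintegral_ge0 => x/=.
by rewrite in_itv/= => /andP[sx _]; apply: f0; rewrite (le_trans as_)// ltW.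
Qed.

Lemma Rintegral_tail l : F t @[t --> +oo] --> l -> forall t, a <= t ->
  mu.-integrable `[t, +oo[ (fun x => (f x)%:E) /\
  (\int[mu]_(x in `[t, +oo[) (f x)%:E = (l - F t)%:E)%E.
Proof.
move=> Fl t at_.
have Ff x : a < x -> is_derive x 1 F (f x) by exact: is_derive_Rintegral.
apply: ge0_integral_itvcy => //.
- exact: within_itvcyS cf.
- by move=> x tx; apply: f0; exact: le_trans tx.
- by move=> x tx; apply: Ff; exact: le_lt_trans tx.
- move: at_; rewrite le_eqVlt => /predU1P[<-|at_].
    have a1 : a < a + 1 by rewrite ltrDl.
    rewrite {2}/F set_itv1 Rintegral_set1; apply: cvg_at_right_filter.
    exact: (parameterized_integral_cvg_left a1 (within_itvcy_integrable (a + 1) cf)).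
  by apply: cvg_at_right_filter; exact: is_derive_continuous (Ff _ at_).
Qed.

(** A nondecreasing function that does not tend to infinity is bounded, hence convergent, and the
    tail formula at [a] would then make the integral finite. *)
Lemma Rintegral_cvg_pinfty : (\int[mu]_(x in `[a, +oo[) (f x)%:E = +oo)%E ->
  F t @[t --> +oo] --> +oo.
Proof.
move=> foo; apply/cvgryPge => A; apply: contrapT => nA.
have [l Fl] : exists l : R, F t @[t --> +oo] --> l.
  apply: (@nondecreasing_bounded_cvg _ a A) => [|t at_]; first exact: Rintegral_nondecreasing.
  rewrite leNgt; apply/negP => At; apply: nA; apply: (@near_ge R t) => s ts.
  by rewrite (le_trans (ltW At))// Rintegral_nondecreasing.
by have [_] := Rintegral_tail Fl (lexx a); rewrite foo.
Qed.

Lemma Rintegral_cvg_lty : (\int[mu]_(x in `[a, +oo[) (f x)%:E < +oo)%E ->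
  exists l : R, F t @[t --> +oo] --> l.
Proof.
move=> foo; have f0' x : [set` `[a, +oo[] x -> (0 <= (f x)%:E)%E.
  by rewrite /= in_itv/= andbT lee_fin => /f0.
apply: (@nondecreasing_bounded_cvg _ a (fine (\int[mu]_(x in `[a, +oo[) (f x)%:E))).
  exact: Rintegral_nondecreasing.
move=> t at_; apply: fine_le.
- apply: integrable_fin_num => //; exact: within_itvcy_integrable.
- by rewrite ge0_fin_numE//; exact: integral_ge0.
- apply: ge0_subset_integral => //; last exact: subset_itvl.
  by apply/measurable_EFinP; exact: within_itvcy_measurable.
Qed.

End nonnegative_integrand.

End integrals_of_continuous_functions.

(** With [k] midway between 1 and [m], eventually [k * g t <= g (2 * t)]. Taking the supremum over a
    half-line avoids iterating: it would be positive, finite and at most itself divided by [k]. *)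
Lemma no_bounded_growth (R : realType) (g : R -> R) (m C : R) :
  (\forall t \near +oo, 0 < g t) -> g (2 * t) / g t @[t --> +oo] --> m -> 1 < m ->
  (\forall t \near +oo, g t <= C) -> False.
Proof.
move=> g0 gm m1 gC; pose k := (1 + m) / 2.
have km : k < m by rewrite /k; lra.
have k1 : 1 < k by rewrite /k; lra.
have k0 : 0 < k by exact: lt_trans k1.
have : \forall t \near +oo, [/\ 0 < g t, k * g t <= g (2 * t) & g t <= C].
  near=> t; have gt0 : 0 < g t by near: t.
  split=> //; last by near: t.
  by rewrite -ler_pdivlMr// ltW//; near: t; exact: cvgr_gt gm _ km.
move=> /(near_pinftyP 0)[T T0 HT].
pose E := [set g t | t in `[T, +oo[].
have ET t : T <= t -> E (g t) by move=> Tt; exists t => //=; rewrite in_itv/= Tt.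
have supE : has_sup E.
  split; first by exists (g T); exact: ET.
  by exists C => x [t] /=; rewrite in_itv/= andbT => /HT[_ _ ?] <-.
have s0 : 0 < sup E.
  by have [gT _ _] := HT T (lexx T); rewrite (lt_le_trans gT)//; apply: sup_upper_bound => //; exact: ET.
have : sup E <= sup E / k.
  apply: ge_sup; first by case: supE.
  move=> x [t] /=; rewrite in_itv/= andbT => Tt <-; have [gt0 gk _] := HT t Tt.
  rewrite ler_pdivlMr// mulrC (le_trans gk)//; apply: sup_upper_bound => //; apply: ET.
  by rewrite (le_trans Tt)// ler_peMl ?ler1n// (le_trans T0).
by rewrite ler_pdivlMr// ger_pMr// leNgt k1.
Unshelve. all: end_near. Qed.

(** * Asymptotics of solutions *)

Lemma powR_inv (R : realType) (x b : R) : 0 < x -> x^-1 `^ b = (x `^ b)^-1.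
Proof. by move=> x0; rewrite -[x^-1]powR_inv1 ?ltW// -powRrM mulN1r powRN. Qed.

Lemma powR_divr (R : realType) (x y b : R) : 0 < x -> 0 < y ->
  (x / y) `^ b = x `^ b / y `^ b.
Proof. by move=> x0 y0; rewrite powRM ?powR_inv ?invr_ge0 ?ltW. Qed.

Lemma is_derive_powR_comp (R : realType) (y : R -> R) (b t d : R) : 0 < y t ->
  is_derive t 1 y d ->
  is_derive t 1 (fun x => y x `^ b) (b * y t `^ (b - 1) * d).
Proof. by move=> y0 yd; exact: (is_derive1_comp (is_derive1_powR b y0) yd). Qed.

Lemma is_derive_sub (R : realType) (f g : R -> R) (t df dg : R) :
  is_derive t 1 f df -> is_derive t 1 g dg ->
  is_derive t 1 (fun x => f x - g x) (df - dg).
Proof. exact: is_deriveB. Qed.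

Lemma is_derive_ln_comp (R : realType) (y : R -> R) (t d : R) : 0 < y t ->
  is_derive t 1 y d -> is_derive t 1 (fun x => ln (y x)) (d / y t).
Proof.
by move=> y0 yd; rewrite mulrC; exact: (is_derive1_comp (is_derive1_ln y0) yd).
Qed.

Section solution_asymptotics.
Context {R : realType}.
Variables (alpha beta : R) (r p P tau : R -> R).
Hypotheses (alpha1 : 1 < alpha) (ab : (alpha - 1) * (beta - 1) = 1).
Hypotheses (p0 : \forall t \near +oo, 0 < p t) (r0 : \forall t \near +oo, 0 < r t).
Hypothesis PE : \forall t \near +oo, is_derive (t : R) 1 P (p t).
Hypothesis Poo : P t @[t --> +oo] --> +oo.
Hypothesis taule : \forall t \near +oo, tau t <= t.
Hypothesis tauoo : tau t @[t --> +oo] --> +oo.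

Variables (y dy q : R -> R).
Let Y t := y t `^ (alpha - 1).
Let dY t := (alpha - 1) * y t `^ (alpha - 1 - 1) * dy t.
Hypothesis yE : \forall t \near +oo, is_derive (t : R) 1 y (dy t).
Hypothesis y0 : \forall t \near +oo, 0 < y t.
Hypothesis qE : \forall t \near +oo, is_derive (t : R) 1 q (p t * Y (tau t)).

Let a0 : 0 < alpha - 1. Proof. by rewrite subr_gt0. Qed.
Let b0 : 0 < beta - 1. Proof. by rewrite -(pmulr_rgt0 _ a0) ab. Qed.

Let P0 : \forall t \near +oo, 0 < P t.
Proof. by move/cvgryPgt : Poo; exact. Qed.

Let YE : \forall t \near +oo, is_derive (t : R) 1 Y (dY t).
Proof.
by apply: filterS2 yE y0 => t yt yt0; exact: is_derive_powR_comp.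
Qed.

Let PYE : \forall t \near +oo,
  is_derive (t : R) 1 (fun x => P x * Y x) (p t * Y t + P t * dY t).
Proof. by apply: filterS2 PE YE => t ? ?; exact: is_derive_prod. Qed.

Let Y0 t : 0 < y t -> 0 < Y t. Proof. by move=> ?; exact: powR_gt0. Qed.

Let YEy t : 0 < y t -> y t `^ (alpha - 1 - 1) = Y t / y t.
Proof.
move=> yt; rewrite (powRD_gt0 _ _ yt) powR_inv1 ?ltW//.
Qed.

Let near_tau (Q : R -> Prop) : (\forall t \near +oo, Q t) -> \forall t \near +oo, Q (tau t).
Proof. by move=> nQ; exact: (tauoo nQ). Qed.

(** The delay has the helpful sign: for nonincreasing [y], [tau t <= t] gives [Y (tau t) >= Y t].
    The resulting bound on [P * Y] is incompatible with its doubling ratio, which tends to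
    2^([delta + 1]) > 1. *)
Lemma nonincreasing_not_SV (delta : R) : -1 < delta -> RVlim delta p ->
  (\forall t \near +oo, dy t <= 0) -> (\forall t \near +oo, q t <= 0) ->
  y (2 * t) / y t @[t --> +oo] --> (1 : R) -> False.
Proof.
move=> d1 pd dyn qn ysv.
have [T T0 HT] : exists2 T : R, 0 <= T & forall t : R, T <= t ->
    [/\ is_derive t 1 y (dy t) /\ dy t <= 0, 0 < y t /\ 0 < p t, 0 <= P t &
     is_derive t 1 (fun x => q x - P x * Y x)
       (p t * Y (tau t) - (p t * Y t + P t * dY t)) /\ q t <= 0].
  apply: near_pinftyP; near=> t; split; [split|split| |split]; try by near: t.
  - by apply/ltW; near: t.
  - by apply: is_derive_sub; near: t.
have yle s t : T <= s -> s <= t -> y t <= y s.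
  move=> Ts st; have : -1 * y s <= -1 * y t; last by lra.
  apply: (@le_of_derive_ge0 R (fun x => -1 * y x) (fun x => -1 * dy x) s t st) => x /andP[sx xt].
    by have [[yx _] _ _ _] := HT x (le_trans Ts sx); exact: is_derive_scale.
  by have [[_ yx] _ _ _] := HT x (le_trans Ts sx); rewrite mulN1r oppr_ge0.
have [T' TT' HT'] : exists2 T', T <= T' & forall t, T' <= t -> T <= tau t /\ tau t <= t.
  by apply: near_pinftyP; apply: filterI taule; move/cvgryPge : tauoo; exact.
have Yle u t : T <= u -> u <= t -> Y t <= Y u.
  move=> Tu ut; have [_ [yu _] _ _] := HT u Tu; have [_ [yt _] _ _] := HT t (le_trans Tu ut).
  by apply: ge0_ler_powR; rewrite ?nnegrE ?(ltW a0) ?(ltW yu) ?(ltW yt)// yle.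
have bd t : T' <= t -> P t * Y t <= P T' * Y T' - q T'.
  move=> T't; have [_ _ _ [_ qt]] := HT t (le_trans TT' T't).
  have : q T' - P T' * Y T' <= q t - P t * Y t; last by lra.
  apply: (@le_of_derive_ge0 R (fun x => q x - P x * Y x)
    (fun t => p t * Y (tau t) - (p t * Y t + P t * dY t)) T' t T't) => x /andP[T'x xt];
    have [[_ dyx] [yx px] Px [qPY _]] := HT x (le_trans TT' T'x) => //.
  have [Ttx txx] := HT' x T'x.
  have : 0 <= p x * (Y (tau x) - Y x) by rewrite mulr_ge0 ?(ltW px)// subr_ge0 Yle.
  have : 0 <= P x * - dY x.
    by rewrite mulr_ge0// /dY -mulrN !mulr_ge0 ?(ltW a0) ?powR_ge0// oppr_ge0.
  by lra.
have PYr : P (2 * t) * Y (2 * t) / (P t * Y t) @[t --> +oo] -->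
    (2 `^ (delta + 1) * 1 `^ (alpha - 1) : R).
  have PR := RVlim_primitive_oo PE p0 pd Poo (ltr0n R 2).
  apply: cvg_eq_near (cvgM PR (@cvg_powR R _ _ (alpha - 1) ltr01 ysv)).
  near=> t => /=.
  have yt : 0 < y t by near: t.
  have y2t : 0 < y (2 * t) by near: t; exact: (near_mul_pinfty (ltr0n R 2) y0).
  have Pt : 0 < P t by near: t.
  rewrite powR_divr// -/(Y (2 * t)) -/(Y t).
  by have Yt := Y0 yt; field; rewrite !gt_eqF//.
apply: (no_bounded_growth _ PYr) => //.
- by near=> t; rewrite mulr_gt0//; [near: t|apply: Y0; near: t].
- rewrite powR1 mulr1 -[ltLHS](powRr0 2) /powR gt_eqF// ltr_expR ltr_pM2r ?ln_gt0 ?ltr1n//.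
  by rewrite -ltrBlDr sub0r.
- exact: near_ge bd.
Unshelve. all: end_near. Qed.

Hypothesis dy0 : \forall t \near +oo, 0 < dy t.
Hypothesis qy : \forall t \near +oo, q t = r t * dy t `^ (alpha - 1).

Let dY0 : \forall t \near +oo, 0 < dY t.
Proof.
apply: filterS2 y0 dy0 => t yt dyt.
by rewrite /dY !mulr_gt0 ?powR_gt0.
Qed.

Let Ybelow : exists2 c : R, 0 < c & \forall t \near +oo, c <= Y t.
Proof.
have [T T0 HT] : exists2 T : R, 0 <= T & forall t : R, T <= t ->
    [/\ is_derive t 1 Y (dY t), 0 < dY t & 0 < y t].
  by apply: near_pinftyP; near=> t; split; near: t.
exists (Y T); first by apply: Y0; have [] := HT T (lexx T).
apply: (@near_ge R T) => t Tt; apply: (le_of_derive_ge0 (df := dY)) => // x /andP[Tx _];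
  by have [? /ltW] := HT x Tx.
Unshelve. all: end_near. Qed.

Lemma PY_cvg_pinfty : P t * Y t @[t --> +oo] --> +oo.
Proof.
have [c c0 cY] := Ybelow; apply/cvgryPge => A; near=> t.
have Pt : `|A| / c <= P t by near: t; move/cvgryPge : Poo; exact.
have ct : c <= Y t by near: t.
by rewrite (le_trans (ler_norm _))// -[leLHS](divfK (lt0r_neq0 c0)) ler_pM ?divr_ge0// ltW.
Unshelve. all: end_near. Qed.

(** Integration gives [q <= P * Y + C]; the factor 2 absorbs [C], since [P] is unbounded and [Y]
    stays above a positive constant. Only the sign of [Y t - Y (tau t)] is used, as the size of the
    delay effect is not yet known. *)
Lemma quasi_le_PY : \forall t \near +oo, q t <= 2 * (P t * Y t).
Proof.
have [T T0 HT] : exists2 T : R, 0 <= T & forall t : R, T <= t ->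
    [/\ is_derive t 1 Y (dY t), 0 <= dY t, 0 <= P t, 0 <= p t &
     is_derive t 1 (fun x => P x * Y x - q x)
       (p t * Y t + P t * dY t - p t * Y (tau t))].
  apply: near_pinftyP; near=> t; split; try by near: t.
  - by apply/ltW; near: t.
  - by apply/ltW; near: t.
  - by apply/ltW; near: t.
  - by apply: is_derive_sub; near: t.
have Yle s t : T <= s -> s <= t -> Y s <= Y t.
  move=> Ts st; apply: (le_of_derive_ge0 (df := dY)) => // x /andP[sx _];
  by have [] := HT x (le_trans Ts sx).
have [T' TT' HT'] : exists2 T' : R, T <= T' & forall t, T' <= t -> T <= tau t /\ tau t <= t.
  by apply: near_pinftyP; apply: filterI taule; move/cvgryPge : tauoo; exact.
have bd t : T' <= t -> q t <= P t * Y t + (q T' - P T' * Y T').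
  move=> T't; have : P T' * Y T' - q T' <= P t * Y t - q t; last by lra.
  apply: (@le_of_derive_ge0 R (fun x => P x * Y x - q x)
    (fun t => p t * Y t + P t * dY t - p t * Y (tau t)) T' t T't) => x /andP[T'x xt];
    have [_ dYx Px px qPY] := HT x (le_trans TT' T'x) => //.
  have [Ttx txx] := HT' x T'x.
  have : 0 <= p x * (Y x - Y (tau x)) by rewrite mulr_ge0// subr_ge0 Yle.
  have : 0 <= P x * dY x by rewrite mulr_ge0.
  by lra.
have [c c0 cY] := Ybelow.
set C := q T' - _ in bd.
near=> t.
have T't : T' <= t by near: t; apply: nbhs_pinfty_ge; exact: num_real.
have Pt : `|C| / c <= P t by near: t; move/cvgryPge : Poo; exact.
have ct : c <= Y t by near: t.
rewrite (le_trans (bd t T't))// mulr_natl mulr2n lerD2l (le_trans (ler_norm _))//.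
by rewrite -[leLHS](divfK (lt0r_neq0 c0)) ler_pM ?divr_ge0// ltW.
Unshelve. all: end_near. Qed.

Lemma log_derivative_cvg0 :
  t `^ (alpha - 1) / r t * P t @[t --> +oo] --> 0 ->
  t * dy t / y t @[t --> +oo] --> 0.
Proof.
move=> small; apply/cvgrPdist_le => e e0.
(* The target is compared after raising to the power [alpha - 1], where [t * dy t / y t] becomes
   [q t / Y t] times the weight of [small]; the half cancels the 2 of [quasi_le_PY]. *)
have e2 : 0 < e `^ (alpha - 1) / 2 by rewrite divr_gt0// powR_gt0.
near=> t.
have t0 : 0 < t by [].
have yt : 0 < y t by near: t.
have dyt : 0 < dy t by near: t.
have rt : 0 < r t by near: t.
have qt : q t = r t * dy t `^ (alpha - 1) by near: t.
have qle : q t <= 2 * (P t * Y t) by near: t; exact: quasi_le_PY.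
have : `|0 - t `^ (alpha - 1) / r t * P t| <= e `^ (alpha - 1) / 2.
  by near: t; move/cvgrPdist_le : small; apply.
rewrite sub0r normrN => /(le_trans (ler_norm _)) h.
have x0 : 0 < t * dy t / y t by rewrite divr_gt0// mulr_gt0.
rewrite sub0r normrN gtr0_norm// leNgt; apply/negP => ex.
have := gt0_ltr_powR a0 (ltW e0) (ltW x0) ex.
rewrite ltNge => /negP; apply.
have -> : (t * dy t / y t) `^ (alpha - 1) = t `^ (alpha - 1) / r t * (q t / Y t).
  rewrite qt powR_divr ?mulr_gt0// powRM ?(ltW t0) ?(ltW dyt)// -/(Y t).
  by have Yt := Y0 yt; field; rewrite !gt_eqF//.
have Yt := Y0 yt.
have : q t / Y t <= 2 * P t by rewrite ler_pdivrMr// -mulrA.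
have tr : 0 <= t `^ (alpha - 1) / r t by rewrite divr_ge0 ?powR_ge0// ltW.
by move=> /(ler_wpM2l tr); lra.
Unshelve. all: end_near. Qed.

Hypothesis lds : t * dy t / y t @[t --> +oo] --> 0.

(** For any [d > 0], eventually the derivative of [ln y] is at most [d / t], so from [tau t] to [t]
    it grows by at most [d * ln (t / tau t)], where the logarithm is bounded. *)
Lemma delayed_ratio_cvg1 M : (\forall t \near +oo, t <= M * tau t) ->
  y (tau t) / y t @[t --> +oo] --> (1 : R).
Proof.
move=> tauM.
suff : ln (y (tau t)) - ln (y t) @[t --> +oo] --> 0.
  move=> /(continuous_cvg _ (@continuous_expR R 0)); rewrite expR0; apply: cvg_eq_near.
  near=> t => /=; rewrite expRB !lnK// posrE; near: t => //.
  exact: (near_tau y0).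
apply/cvgrPdist_le => e e0.
(* Enlarging [M] to at least 2 makes [ln M'] positive, hence a legitimate divisor of [e]. *)
pose M' := Num.max M 2.
have M1 : 0 < ln M' by rewrite ln_gt0// lt_max ltr1n orbT.
have d0 : 0 < e / ln M' by rewrite divr_gt0.
have [T T0 HT] : exists2 T : R, 1 <= T & forall t : R, T <= t ->
    [/\ is_derive t 1 (fun x => ln (y x)) (dy t / y t), 0 < dy t / y t &
     t * dy t / y t <= e / ln M'].
  apply: near_pinftyP; near=> t; split.
  - by apply: is_derive_ln_comp; near: t.
  - by rewrite divr_gt0//; near: t.
  - by near: t; exact: cvgr_le lds _ d0.
near=> t.
have tt : tau t <= t by near: t.
have Tt : T <= tau t by near: t; move/cvgryPge : tauoo; exact.
have tau0 : 0 < tau t by rewrite (lt_le_trans _ Tt)// (lt_le_trans ltr01).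
have t0 : 0 < t by exact: lt_le_trans tt.
have tM : t <= M' * tau t.
  rewrite (@le_trans _ _ (M * tau t))//; first by near: t.
  by rewrite ler_pM2r// le_max lexx.
rewrite sub0r normrN ler0_norm.
  rewrite opprB.
  have h : (e / ln M') * ln (tau t) - ln (y (tau t)) <= (e / ln M') * ln t - ln (y t).
    apply: (@le_of_derive_ge0 R (fun x => e / ln M' * ln x - ln (y x))
      (fun x => e / ln M' * x^-1 - dy x / y x)) => // x /andP[tx _];
      have [lx _ le] := HT x (le_trans Tt tx); have x0 := lt_le_trans tau0 tx.
      by apply: is_derive_sub => //; apply: is_derive_scale; exact: is_derive1_ln.
    by rewrite subr_ge0 ler_pdivlMr// mulrC mulrA.
  have : ln t <= ln M' + ln (tau t).
    have M'0 : 0 < M' by rewrite lt_max ltr0n orbT.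
    by rewrite -lnM ?posrE// ler_ln ?posrE ?mulr_gt0.
  rewrite -lerBlDr => /(ler_wpM2l (ltW d0)); rewrite divfK ?gt_eqF//; lra.
rewrite subr_le0; apply: (@le_of_derive_ge0 R (fun x => ln (y x)) (fun x => dy x / y x)) => //;
  by move=> x /andP[tx _]; have [? /ltW] := HT x (le_trans Tt tx).
Unshelve. all: end_near. Qed.

Hypothesis ydelay : y (tau t) / y t @[t --> +oo] --> (1 : R).

(** After division by [p * Y], the quotient of derivatives has numerator [(y (tau t) / y t)] to the
    power [alpha - 1] and denominator 1 plus [alpha - 1] times the product of [P t / (t * p t)],
    which converges, and [t * dy t / y t], which tends to 0. *)
Lemma quasi_asymp (delta : R) : P t / (t * p t) @[t --> +oo] --> (delta + 1)^-1 ->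
  q t / (P t * Y t) @[t --> +oo] --> (1 : R).
Proof.
move=> kar.
have PYoo := PY_cvg_pinfty.
apply: (lhopital_pinfty_oo qE PYE _ _ PYoo).
  near=> t; have pt : 0 < p t by near: t.
  have Yt : 0 < Y t by apply: Y0; near: t.
  have Pt : 0 < P t by near: t.
  have dYt : 0 < dY t by near: t.
  by rewrite addr_gt0// mulr_gt0.
have den : 1 + (alpha - 1) * (P t / (t * p t) * (t * dy t / y t)) @[t --> +oo] -->
    1 + (alpha - 1) * ((delta + 1)^-1 * 0).
  by apply: cvgD; [exact: cvg_cst|apply: cvgMl_tmp; exact: cvgM].
rewrite !mulr0 addr0 in den.
have -> : 1 = 1 `^ (alpha - 1) / 1 :> R by rewrite powR1 divr1.
apply: cvg_eq_near (cvgM (@cvg_powR R _ _ (alpha - 1) ltr01 ydelay) (cvgV (oner_neq0 _) den)).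
near=> t => /=.
have yt : 0 < y t by near: t.
have yst : 0 < y (tau t) by near: t; exact: (near_tau y0).
have pt : 0 < p t by near: t.
have Pt : 0 < P t by near: t.
have dyt : 0 < dy t by near: t.
have t0 : 0 < t by [].
have Yt := Y0 yt.
rewrite powR_divr// -/(Y (tau t)) -/(Y t).
rewrite /dY YEy//.
have -> : p t * Y t + P t * ((alpha - 1) * (Y t / y t) * dy t) =
  p t * Y t * (1 + (alpha - 1) * (P t / (t * p t) * (t * dy t / y t))).
  by field; rewrite !gt_eqF.
have : 0 < 1 + (alpha - 1) * (P t / (t * p t) * (t * dy t / y t)).
  by rewrite addr_gt0// mulr_gt0// mulr_gt0// ?divr_gt0 ?mulr_gt0.
set D := 1 + _ => D0.
by field; rewrite !gt_eqF.
Unshelve. all: end_near. Qed.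

Lemma quasi_cvg_pinfty (delta : R) : P t / (t * p t) @[t --> +oo] --> (delta + 1)^-1 ->
  q t @[t --> +oo] --> +oo.
Proof.
move=> /quasi_asymp qPY; apply/cvgryPge => A; near=> t.
have PYt : 2 * `|A| <= P t * Y t by near: t; move/cvgryPge : PY_cvg_pinfty; exact.
have PY0 : 0 < P t * Y t by near: t; move/cvgryPgt : PY_cvg_pinfty; exact.
have : 2^-1 <= q t / (P t * Y t).
  by near: t; apply: cvgr_ge qPY _ _; rewrite invf_lt1// ltr1n.
rewrite ler_pdivlMr// => h; have := ler_norm A; lra.
Unshelve. all: end_near. Qed.

(** Multiplying [q ~ P * Y] by Karamata's limit for [P] gives the asymptotics of [dy t / y t] to the
    power [alpha - 1]; the power [beta - 1] undoes it because [(alpha - 1) * (beta - 1) = 1]. *)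
Lemma log_derivative_asymp (delta : R) : -1 < delta ->
  P t / (t * p t) @[t --> +oo] --> (delta + 1)^-1 ->
  dy t / y t / (t * p t / r t) `^ (beta - 1) @[t --> +oo] -->
    ((delta + 1) `^ (beta - 1))^-1.
Proof.
move=> d1 kar; have d0 : 0 < delta + 1 by rewrite -ltrBlDr sub0r.
rewrite -powR_inv//.
have lim : q t / (P t * Y t) * (P t / (t * p t)) @[t --> +oo] --> (delta + 1)^-1.
  by rewrite -[X in _ --> X]mul1r; apply: cvgM => //; exact: quasi_asymp kar.
have d0' : 0 < (delta + 1)^-1 by rewrite invr_gt0.
apply: cvg_eq_near (@cvg_powR R _ _ (beta - 1) d0' lim); near=> t => /=.
have yt : 0 < y t by near: t.
have dyt : 0 < dy t by near: t.
have rt : 0 < r t by near: t.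
have pt : 0 < p t by near: t.
have Pt : 0 < P t by near: t.
have t0 : 0 < t by [].
have Yt := Y0 yt.
have qt : q t = r t * dy t `^ (alpha - 1) by near: t.
have z0 : 0 < dy t / y t by exact: divr_gt0.
have G0 : 0 < t * p t / r t by rewrite divr_gt0// mulr_gt0.
have -> : dy t / y t = ((dy t / y t) `^ (alpha - 1)) `^ (beta - 1).
  by rewrite -powRrM ab powRr1// ltW.
rewrite -powR_divr ?powR_gt0//; congr (_ `^ _).
rewrite powR_divr// -/(Y t) qt.
by field; rewrite !gt_eqF.
Unshelve. all: end_near. Qed.

End solution_asymptotics.

(** * Eventual differential identities for solutions *)

Lemma Phi_gt0E (R : realType) (a u : R) : 0 < u -> Phi a u = u `^ (a - 1).
Proof. by move=> u0; rewrite /Phi gtr0_sg// mul1r gtr0_norm. Qed.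

Lemma Phi_gt0 (R : realType) (a u : R) : (0 < Phi a u) = (0 < u).
Proof.
rewrite /Phi; case: (ltrgt0P u) => [u0|u0|->].
- by rewrite gtr0_sg// mul1r powR_gt0.
- by rewrite ltr0_sg// mulN1r oppr_gt0 ltNge powR_ge0.
- by rewrite sgr0 mul0r ltxx.
Qed.

Lemma continuous_near_eq (R : realType) (f g : R -> R) (t : R) :
  (\forall x \near t, f x = g x) -> {for t, continuous g} -> {for t, continuous f}.
Proof.
move=> fg cg; rewrite /prop_for /continuous_at (nbhs_singleton fg).
by apply: cvg_trans cg; apply: near_eq_cvg; apply: filterS fg => x ->.
Qed.

Lemma is_derive_near_eq (R : realType) (f g : R -> R) (t d : R) :
  (\forall x \near t, f x = g x) -> is_derive t 1 g d -> is_derive t 1 f d.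
Proof.
move=> fg [dg <-]; have v1 : (1 : R) != 0 by exact: oner_neq0.
apply: DeriveDef; last exact: near_eq_derive.
by apply: near_eq_derivable dg => //; apply: filterS fg => x ->.
Qed.

Lemma solS_eventually (R : realType) (a alpha : R) (r p tau y : R -> R) :
  tau t @[t --> +oo] --> +oo -> solS a alpha r p tau y ->
  exists T0 : R, forall t : R, T0 <= t ->
    [/\ is_derive t 1 y (derive1 y t),
        is_derive t 1 (quasi alpha r y) (p t * y (tau t) `^ (alpha - 1)),
        0 < y t & {for t, continuous (derive1 y)}].
Proof.
move=> tauoo [T [[_ _ [dy [dq [y1 q1 dqE]]]] y0]].
(* Beyond [T + 1] the derivatives are two-sided and agree with [derive1 y]; [T <= tau t] makes the
   delayed value positive, so that [Phi] is a pure power there. *)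
have [T0 TT0 HT0] : exists2 T0, T + 1 <= T0 & forall t, T0 <= t -> T <= tau t.
  by apply: near_pinftyP; move/cvgryPge : tauoo; exact.
exists T0 => t T0t.
have Tt : T < t by rewrite (lt_le_trans _ T0t)// (lt_le_trans _ TT0)// ltrDl.
have yE x : T < x -> is_derive x 1 y (dy x) by exact: C1_on_is_derive.
have dyE : \forall x \near t, derive1 y x = dy x.
  near=> x; have Tx : T < x by near: x; exact: lt_nbhsr.
  by rewrite derive1E; have [_ ->] := yE x Tx.
split.
- by rewrite (nbhs_singleton dyE); exact: yE.
- have -> : y (tau t) `^ (alpha - 1) = Phi alpha (y (tau t)).
    by rewrite Phi_gt0E// y0// HT0.
  rewrite -dqE; last by rewrite /= in_itv/= andbT ltW.
  apply: is_derive_near_eq (C1_on_is_derive q1 Tt).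
  by apply: filterS dyE => x xE; rewrite /quasi xE.
- exact/y0/ltW.
- by apply: continuous_near_eq dyE _; exact: within_itvcy_continuous (y1.1) _ Tt.
Unshelve. all: end_near. Qed.

(** * Normalized slow variation *)

Section normalized.
Context {R : realType}.
Notation mu := (@lebesgue_measure R).

Lemma NSV_RVlim (f : R -> R) : NSV f -> RVlim 0 f.
Proof.
move=> [t0 [C [psi [t00 C0 mpsi psi0 fE]]]].
pose E t := expR (\int[mu]_(s in `[t0, t]) (psi s / s)).
have ge1 (l : R) : 1 <= l -> f (l * t) / f t @[t --> +oo] --> (1 : R).
  move=> l1; have l0 : 0 < l by exact: lt_le_trans l1.
  have fI : \forall t \near +oo, mu.-integrable `[t0, t] (fun s => (psi s / s)%:E).
    by apply: filterS fE => ? [].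
  have : \int[mu]_(s in `]t, l * t]) (psi s / s) @[t --> +oo] --> 0.
    apply/cvgrPdist_le => e e0.
    (* With [psi] at most [e / l] in absolute value, the integral over an interval of length
       [(l - 1) * t] is at most [e * (1 - l^-1)], hence at most [e]. *)
    have d0 : 0 < e / l by rewrite divr_gt0.
    have [T t0T HT] : exists2 T : R, t0 <= T & forall t, T <= t -> `|psi t| <= e / l.
      by apply: near_pinftyP; move/cvgr0Pnorm_le : psi0; exact.
    near=> t; have Tt : T <= t by near: t; apply: nbhs_pinfty_ge; exact: num_real.
    have t_gt0 : 0 < t by exact: lt_le_trans (le_trans t0T Tt).
    have tl : t <= l * t by rewrite ler_peMl// ltW.
    have I : mu.-integrable `]t, l * t] (fun s => (psi s / s)%:E).
      have : mu.-integrable `[t0, l * t] (fun s => (psi s / s)%:E).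
        by near: t; exact: (near_mul_pinfty l0 fI).
      apply: integrableS => //; apply: subset_itvr; rewrite bnd_simp.
      by rewrite (le_trans t0T).
    rewrite sub0r normrN (le_trans (le_normr_Rintegral _ I))//.
    apply: (@le_trans _ _ (\int[mu]_(s in `]t, l * t]) (e / l / t))).
      apply: le_Rintegral => //.
      - exact: (integrable_norm I).
      - have : mu.-integrable `[t, l * t] (fun=> (e / l / t)%:E).
          apply: (@within_itvcy_integrable R (cst (e / l / t)) t (l * t)).
          by apply: continuous_subspaceT; exact: cst_continuous.
        by apply: integrableS => //; apply: subset_itvr; rewrite bnd_simp.
      - move=> x; rewrite /= in_itv/= => /andP[tx _].
        have x0 : 0 < x by exact: lt_trans tx.
        rewrite normrM ler_pM// ?HT ?(le_trans Tt (ltW tx))//.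
        by rewrite normfV gtr0_norm// lef_pV2// ?posrE// ltW.
    rewrite Rintegral_cst//= lebesgue_measure_itv/= lte_fin.
    case: ifP => [_|_]; last by rewrite mulr0 ltW.
    rewrite -EFinB/=.
    have -> : e / l / t * (l * t - t) = e * (1 - l^-1) by field; rewrite !gt_eqF.
    by rewrite ger_pMr// gerBl invr_ge0 ltW.
  move=> /(continuous_cvg _ (@continuous_expR R 0)); rewrite expR0; apply: cvg_eq_near.
  near=> t => /=.
  have t_gt0 : 0 < t by [].
  have tl : t <= l * t by rewrite ler_peMl// ltW.
  have [_ ft] : mu.-integrable `[t0, t] (fun s => (psi s / s)%:E) /\
      f t = C * t `^ 0 * expR (\int[mu]_(s in `[t0, t]) (psi s / s)) by near: t.
  have [I flt] : mu.-integrable `[t0, l * t] (fun s => (psi s / s)%:E) /\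
      f (l * t) = C * (l * t) `^ 0 * expR (\int[mu]_(s in `[t0, l * t]) (psi s / s)).
    by near: t; exact: (near_mul_pinfty l0 fE).
  have t0t : t0 <= t by near: t; apply: nbhs_pinfty_ge; exact: num_real.
  have := @Rintegral_itvB R _ (BLeft t0) (BRight (l * t)) t I.
  rewrite !bnd_simp => /(_ t0t tl) <-.
  by rewrite expRB ft flt !powRr0 !mulr1; field; rewrite !gt_eqF ?expR_gt0.
(* For [l < 1] the quotient is the inverse of the one for [l^-1], taken at [l * t]. *)
move=> l l0; rewrite powRr0; have [l1|l1] := leP 1 l; first exact: ge1.
have li1 : 1 <= l^-1 by rewrite invf_ge1// ltW.
have lim := cvg_comp _ _ (cvg_mul_pinfty l0) (ge1 _ li1).
rewrite -[X in _ --> X]invr1; apply: cvg_eq_near (cvgV (oner_neq0 R) lim).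
near=> t => /=; rewrite mulrA mulVf ?gt_eqF// mul1r invf_div//.
Unshelve. all: end_near. Qed.

(** The witness [psi] is [t * df t / f t]: then [psi s / s] is the derivative of [ln f], and the
    constant is [f T]. *)
Lemma log_derivative_NSV (f df : R -> R) :
  (\forall t \near +oo, is_derive (t : R) 1 f (df t)) ->
  (\forall t \near +oo, 0 < f t) -> (\forall t \near +oo, {for t, continuous df}) ->
  t * df t / f t @[t --> +oo] --> 0 -> NSV f.
Proof.
move=> fE f0 cdf psi0.
have [T T1 HT] : exists2 T : R, 1 <= T & forall t : R, T <= t ->
    [/\ is_derive t 1 f (df t), 0 < f t & {for t, continuous df}].
  by apply: near_pinftyP; near=> t; split; near: t.
have T0 : 0 < T by exact: lt_le_trans T1.
have [_ fT _] := HT T (lexx T).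
have cpsi : {within `[T, +oo[, continuous (fun t => t * df t / f t)}.
  apply: continuous_within_itvcy => t Tt; have [ft ft0 cdft] := HT t Tt.
  apply: cvgM; first by apply: cvgM => //; exact: cvg_id.
  by apply: cvgV; [exact: lt0r_neq0|exact: is_derive_continuous ft].
have cpsit : {within `[T, +oo[, continuous (fun t => t * df t / f t / t)}.
  apply: continuous_within_itvcy => t Tt; have [ft ft0 cdft] := HT t Tt.
  have t0 : 0 < t by exact: lt_le_trans Tt.
  apply: cvgM; last by apply: cvgV; [exact: lt0r_neq0|exact: cvg_id].
  apply: cvgM; first by apply: cvgM => //; exact: cvg_id.
  by apply: cvgV; [exact: lt0r_neq0|exact: is_derive_continuous ft].
exists T, (f T), (fun t => t * df t / f t); split => //.
  exact: within_itvcy_measurable.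
apply: (@near_ge R T) => t Tt; split; first exact: within_itvcy_integrable.
have [_ ft _] := HT t Tt.
have lnE x : T <= x -> is_derive x 1 (fun t => ln (f t)) (x * df x / f x / x).
  move=> Tx; have [fx fx0 _] := HT x Tx.
  have -> : x * df x / f x / x = df x / f x.
    by field; rewrite !gt_eqF// (lt_le_trans T0).
  exact: is_derive_ln_comp.
rewrite powRr0 mulr1 (Rintegral_FTC2 Tt cpsit lnE).
by rewrite expRB !lnK ?posrE// mulrC divfK ?gt_eqF.
Unshelve. all: end_near. Qed.

End normalized.

(** * Functions with prescribed logarithmic derivative *)

Section relative_growth.
Context {R : realType}.
Notation mu := (@lebesgue_measure R).
Variables (a c : R) (G y dy : R -> R).
Hypotheses (cG : {within `[a, +oo[, continuous G}) (G0 : forall t, a <= t -> 0 < G t).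
Hypothesis c0 : 0 < c.
Hypothesis yE : \forall t \near +oo, is_derive (t : R) 1 y (dy t).
Hypothesis y0 : \forall t \near +oo, 0 < y t.
Hypothesis cdy : \forall t \near +oo, {for t, continuous dy}.
Hypothesis yG : dy t / y t / G t @[t --> +oo] --> c^-1.

Let FG t := \int[mu]_(s in `[a, t]) G s.
Let FGE t : a < t -> is_derive t 1 FG (G t). Proof. exact: is_derive_Rintegral. Qed.

(** The constant [2 / c] is merely a convenient number above the limit [c^-1]; this upper bound lets
    a finite integral of [G] bound [ln y]. *)
Let yT : exists2 T : R, a < T & forall t : R, T <= t ->
  [/\ is_derive t 1 (fun x => ln (y x)) (dy t / y t), 0 < y t, 0 < dy t / y t,
   dy t / y t <= 2 / c * G t & {for t, continuous (fun x => dy x / y x)}].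
Proof.
have [T aT HT] : exists2 T : R, a + 1 <= T & forall t : R, T <= t ->
  [/\ is_derive t 1 (fun x => ln (y x)) (dy t / y t), 0 < y t, 0 < dy t / y t,
   dy t / y t <= 2 / c * G t & {for t, continuous (fun x => dy x / y x)}].
  have c2 : c^-1 < 2 / c by rewrite ltr_pMl ?ltr1n// invr_gt0.
  apply: near_pinftyP; near=> t.
  have yt : 0 < y t by near: t.
  have Gt : 0 < G t by apply: G0; near: t; apply: nbhs_pinfty_ge; exact: num_real.
  split => //.
  - by apply: is_derive_ln_comp => //; near: t.
  - have : 0 < dy t / y t / G t by near: t; apply: cvgr_gt yG _ _; rewrite invr_gt0.
    by rewrite pmulr_lgt0 ?invr_gt0.
  - rewrite -ler_pdivrMr//; near: t; exact: (cvgr_le _ yG _ c2).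
  - apply: cvgM; first by near: t.
    apply: cvgV; first exact: lt0r_neq0.
    have yt' : is_derive (t : R) 1 y (dy t) by near: t.
    exact: is_derive_continuous yt'.
by exists T => //; rewrite (lt_le_trans _ aT)// ltrDl.
Unshelve. all: end_near. Qed.

Lemma exp_integral_representation : exists eps : R -> R, eps s @[s --> +oo] --> 0 /\
  \forall t \near +oo,
    mu.-integrable `[a, t] (fun s => ((1 + eps s) * (G s / c))%:E) /\
    y t = expR (\int[mu]_(s in `[a, t]) ((1 + eps s) * (G s / c))).
Proof.
have [T aT HT] := yT.
have FT0 : 0 < FG T.
  (* [FG T] becomes a divisor in [K]. The midpoint keeps the strict monotonicity argument away from
     [a], since the derivative of [FG] is available only beyond [a]. *)
  have aT2 : a < (a + T) / 2 by lra.
  have T2T : (a + T) / 2 < T by lra.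
  have F0 : 0 <= FG ((a + T) / 2).
    by apply: Rintegral_ge0 => x; rewrite /= in_itv/= => /andP[/G0/ltW].
  apply: le_lt_trans F0 _; apply: (lt_of_derive_gt0 (df := G)) => // x /andP[ax _].
    by apply: FGE; exact: lt_le_trans ax.
  by apply: G0; rewrite ltW// (lt_le_trans aT2).
pose K := ln (y T) / FG T.
(* The correction on [a, T] only has to give the integral the right value at T. *)
pose k s := if s < T then K * G s else dy s / y s.
(* This solves [(1 + eps s) * (G s / c) = k s] for [eps]. *)
exists (fun s => k s * c / G s - 1); split.
  have -> : 0 = c^-1 * c - 1 :> R by rewrite mulVf ?subrr// gt_eqF.
  apply: cvgB; last exact: cvg_cst.
  apply: (@cvg_eq_near _ _ (fun t => dy t / y t / G t * c)).
    by apply: (@near_ge R T) => t Tt; rewrite /k ltNge Tt/= mulrAC.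
  exact: cvgMr_tmp.
have kE s : a <= s -> (1 + (k s * c / G s - 1)) * (G s / c) = k s.
  by move=> as_; have Gs := G0 as_; field; rewrite !gt_eqF.
apply: (@near_ge R T) => t Tt.
have tU : [set` `[a, t]] = [set` `[a, T[] `|` [set` `[T, t]].
  by rewrite (@itv_bndbnd_setU _ _ _ (BLeft T))// bnd_simp// ltW.
have dj : [disjoint [set` `[a, T[] & [set` `[T, t]]].
  apply/disj_setPS => x [/=]; rewrite !in_itv/= => /andP[_ xT] /andP[Tx _].
  by move: xT; rewrite ltNge Tx.
have i1 : mu.-integrable `[a, T[ (fun s => (k s)%:E).
  apply: (@integrable_eq_in R _ (fun s => K * G s)) => //.
    by move=> s; rewrite /= in_itv/= => /andP[_ sT]; rewrite /k sT.
  have : mu.-integrable `[a, T] (fun s => (K%:E * (G s)%:E)%E).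
    by apply: integrableZl => //; exact: within_itvcy_integrable.
  by apply: integrableS => //; apply: subset_itvl; rewrite bnd_simp.
have cT : {within `[T, +oo[, continuous (fun s => dy s / y s)}.
  by apply: continuous_within_itvcy => s /HT[].
have kT s : T <= s -> k s = dy s / y s by move=> Ts; rewrite /k ltNge Ts.
have i2 : mu.-integrable `[T, t] (fun s => (k s)%:E).
  apply: (@integrable_eq_in R _ (fun s => dy s / y s)) => //.
    by move=> s; rewrite /= in_itv/= => /andP[Ts _]; rewrite kT.
  exact: within_itvcy_integrable cT.
have ik : mu.-integrable `[a, t] (fun s => (k s)%:E).
  by rewrite tU; exact: integrable_setU.
split.
  apply: (@integrable_eq_in R _ k) => //.
  by move=> s; rewrite /= in_itv/= => /andP[as_ _]; rewrite kE.
have -> : \int[mu]_(s in `[a, t]) ((1 + (k s * c / G s - 1)) * (G s / c)) =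
    \int[mu]_(s in `[a, t]) k s.
  by apply: eq_Rintegral => s; rewrite inE/= in_itv/= => /andP[as_ _]; rewrite kE.
have lnE x : T <= x -> is_derive x 1 (fun s => ln (y s)) (dy x / y x) by case/HT.
rewrite tU Rintegral_setU//; last by rewrite -tU.
have -> : \int[mu]_(s in `[a, T[) k s = \int[mu]_(s in `[a, T[) (K * G s).
  by apply: eq_Rintegral => s; rewrite inE/= in_itv/= => /andP[_ sT]; rewrite /k sT.
have -> : \int[mu]_(s in `[T, t]) k s = \int[mu]_(s in `[T, t]) (dy s / y s).
  by apply: eq_Rintegral => s; rewrite inE/= in_itv/= => /andP[Ts _]; rewrite kT.
have iG : mu.-integrable `[a, T[ (fun s => (G s)%:E).
  apply: integrableS (within_itvcy_integrable T cG) => //.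
  by apply: subset_itvl; rewrite bnd_simp.
rewrite RintegralZl// Rintegral_itv_bndo_bndc// (Rintegral_FTC2 Tt cT lnE) -/(FG T).
by rewrite /K divfK ?gt_eqF// addrC subrK lnK// posrE; have [] := HT t Tt.
Qed.

(** By l'Hopital's rule [ln y] is asymptotic to [FG / c], hence eventually at least [FG / (2 * c)],
    and [y] exceeds its logarithm. *)
Lemma relative_growth_cvg_pinfty : FG t @[t --> +oo] --> +oo -> y t @[t --> +oo] --> +oo.
Proof.
move=> FGoo; have [T aT HT] := yT.
have lnFG : ln (y t) / FG t @[t --> +oo] --> c^-1.
  apply: (lhopital_pinfty_oo _ _ _ yG FGoo).
  - by apply: (@near_ge R T) => t /HT[].
  - by apply: (@near_ge R T) => t Tt; apply: FGE; exact: lt_le_trans Tt.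
  - exact: near_ge G0.
apply/cvgryPge => A; near=> t.
have yt : 0 < y t by near: t.
have Ft : `|A| * (2 * c) <= FG t by near: t; move/cvgryPge : FGoo; exact.
have Ft0 : 0 < FG t by near: t; move/cvgryPgt : FGoo; exact.
have : (2 * c)^-1 <= ln (y t) / FG t.
  near: t; apply: cvgr_ge lnFG _ _; rewrite ltf_pV2 ?posrE ?mulr_gt0//.
  by rewrite ltr_pMl ?ltr1n.
rewrite ler_pdivlMr// => h.
rewrite (le_trans _ (ltW (ln_sublinear yt)))// (le_trans _ h)//.
by rewrite (le_trans (ler_norm _))// ler_pdivlMl ?mulr_gt0// mulrC.
Unshelve. all: end_near. Qed.

(** Convergence is proved for [ln y], which is nondecreasing and bounded because [ln y - 2 / c * FG]
    is nonincreasing; exponentiating then makes the limit positive for free. *)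
Lemma relative_growth_cvg (l : R) : FG t @[t --> +oo] --> l ->
  exists2 N : R, 0 < N & y t @[t --> +oo] --> N.
Proof.
move=> FGl; have [T aT HT] := yT.
have lnle s t : T <= s -> s <= t -> ln (y s) <= ln (y t).
  move=> Ts st; apply: (@le_of_derive_ge0 R (fun x => ln (y x)) (fun x => dy x / y x) s t st) => x /andP[sx _];
  by have [? _ /ltW] := HT x (le_trans Ts sx).
have FGle s t : a <= s -> s <= t -> FG s <= FG t.
  by apply: Rintegral_nondecreasing => // x /G0/ltW.
have FGb t : a <= t -> FG t <= l.
  move=> at_; apply: (cvgr_to_ge FGl); apply: (@near_ge R t) => s ts; exact: FGle.
have [L HL] : exists L : R, ln (y t) @[t --> +oo] --> L.
  apply: (@nondecreasing_bounded_cvg _ _ T (ln (y T) + 2 / c * (l - FG T))) => // t Tt.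
  have at_ : a <= t := le_trans (ltW aT) Tt.
  have : 2 / c * FG T - ln (y T) <= 2 / c * FG t - ln (y t).
    apply: (@le_of_derive_ge0 R (fun x => 2 / c * FG x - ln (y x))
      (fun x => 2 / c * G x - dy x / y x) T t Tt) => x /andP[Tx _]; have [? _ _ ? _] := HT x Tx.
      apply: is_derive_sub => //; apply: is_derive_scale; apply: FGE.
      exact: lt_le_trans Tx.
    by rewrite subr_ge0.
  have : 2 / c * FG t <= 2 / c * l by rewrite ler_pM2l ?FGb// divr_gt0.
  by lra.
exists (expR L); first exact: expR_gt0.
apply: cvg_eq_near (continuous_cvg _ (@continuous_expR R L) HL).
by near=> t; rewrite lnK// posrE; near: t.
Unshelve. all: end_near. Qed.

(** The tail integral of [dy / y] from [t] is [ln N - ln (y t)]. It involves only values beyond [t],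
    so [eps] needs no correction on an initial segment. *)
Lemma exp_tail_representation (N : R) : 0 < N -> y t @[t --> +oo] --> N ->
  exists eps : R -> R, eps s @[s --> +oo] --> 0 /\
  \forall t \near +oo,
    mu.-integrable `[t, +oo[ (fun s => ((1 + eps s) * (G s / c))%:E) /\
    y t = N * expR (- \int[mu]_(s in `[t, +oo[) ((1 + eps s) * (G s / c))).
Proof.
move=> N0 yN; have [T aT HT] := yT.
exists (fun s => dy s / y s * c / G s - 1); split.
  have -> : 0 = c^-1 * c - 1 :> R by rewrite mulVf ?subrr// gt_eqF.
  apply: cvgB; last exact: cvg_cst.
  under eq_fun do rewrite mulrAC.
  exact: cvgMr_tmp.
have kE s : a <= s -> (1 + (dy s / y s * c / G s - 1)) * (G s / c) = dy s / y s.
  move=> as_; have Gs := G0 as_; rewrite addrC subrK.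
  by set d := dy s / _; field; rewrite !gt_eqF.
apply: (@near_ge R T) => t Tt.
have at_ : a <= t := le_trans (ltW aT) Tt.
have ct : {within `[t, +oo[, continuous (fun s => dy s / y s)}.
  by apply: continuous_within_itvcy => s ts; have [] := HT s (le_trans Tt ts).
have lnN : ln (y t) @[t --> +oo] --> ln N by exact: cvg_ln.
have [|x tx||i e] := ge0_integral_itvcy ct _ _ _ lnN.
- by move=> x tx; have [_ _ /ltW] := HT x (le_trans Tt tx).
- by have [] := HT x (le_trans Tt (ltW tx)).
- by apply: cvg_at_right_filter; have [lt _ _ _ _] := HT t Tt; exact: is_derive_continuous lt.
split.
  apply: (@integrable_eq_in R _ (fun s => dy s / y s)) => //.
  by move=> s; rewrite /= in_itv/= andbT => ts; rewrite kE// (le_trans at_).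
have -> : \int[mu]_(s in `[t, +oo[) ((1 + (dy s / y s * c / G s - 1)) * (G s / c)) =
    \int[mu]_(s in `[t, +oo[) (dy s / y s).
  apply: eq_Rintegral => s; rewrite inE/= in_itv/= andbT => ts.
  by rewrite kE// (le_trans at_).
have [_ yt _ _ _] := HT t Tt.
rewrite /Rintegral e/= opprB expRB !lnK ?posrE//.
by rewrite mulrC divfK ?gt_eqF.
Qed.

End relative_growth.

(** * Regularly varying [G]: increments, tails and remainders *)

Lemma RVlim_near_eq (R : realType) (f g : R -> R) (theta : R) :
  (\forall t \near +oo, f t = g t) -> RVlim theta g -> RVlim theta f.
Proof.
move=> fg gth l l0; apply: cvg_eq_near (gth l l0).
near=> t; congr (_ / _); near: t => //.
exact: (near_mul_pinfty (P := fun t => f t = g t) l0 fg).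
Unshelve. all: end_near. Qed.

Lemma RVlim_scale (R : realType) (f : R -> R) (k theta : R) : k != 0 ->
  RVlim theta f -> RVlim theta (fun t => k * f t).
Proof.
move=> k0 fth l l0; under eq_fun do rewrite -mulf_div divff// mul1r.
exact: fth.
Qed.

(** If the integral diverged, its primitive would have index [rho + 1 < 0], so its doubling ratio
    would tend to a number below 1, although the primitive is nondecreasing. *)
Lemma integral_lty_RVlim (R : realType) (G : R -> R) (a rho : R) :
  {within `[a, +oo[, continuous G} -> (forall t, a <= t -> 0 < G t) ->
  RVlim rho G -> rho < -1 ->
  (\int[@lebesgue_measure R]_(s in `[a, +oo[) (G s)%:E < +oo)%E.
Proof.
move=> cG G0 GR rho1; rewrite ltey; apply/eqP => Goo.
pose FG t := \int[@lebesgue_measure R]_(s in `[a, t]) G s.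
have FGE t : a < t -> is_derive t 1 FG (G t) by exact: is_derive_Rintegral.
have FGoo : FG t @[t --> +oo] --> +oo.
  by apply: Rintegral_cvg_pinfty => // t /G0/ltW.
have nFGE : \forall t \near +oo, is_derive (t : R) 1 FG (G t).
  by apply: filterS (nbhs_pinfty_gt (num_real a)) => t; exact: FGE.
have F2 := RVlim_primitive_oo nFGE (near_ge G0) GR FGoo (ltr0n R 2).
have : 1 <= 2 `^ (rho + 1) :> R.
  apply: (cvgr_to_ge F2); near=> t.
  have FG0 : 0 < FG t by near: t; move/cvgryPgt : FGoo; exact.
  have at_ : a <= t by near: t; apply: nbhs_pinfty_ge; exact: num_real.
  have tt : t <= 2 * t.
    have t0 : 0 < t by [].
    by rewrite ler_peMl ?ler1n// ltW.
  rewrite ler_pdivlMr// mul1r.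
  exact: (Rintegral_nondecreasing cG (fun x ax => ltW (G0 x ax)) at_ tt).
rewrite -[leLHS](powRr0 2) /powR gt_eqF// ler_expR ler_pM2r ?ln_gt0 ?ltr1n//.
by rewrite leNgt -ltrBrDr sub0r rho1.
Unshelve. all: end_near. Qed.

Lemma is_derive_subr (R : realType) (f : R -> R) (k t d : R) : is_derive t 1 f d ->
  is_derive t 1 (fun x => f x - k) d.
Proof.
by move=> fd; rewrite -[d]subr0; apply: is_derive_sub => //; exact: is_derive_cst.
Qed.

Lemma primitive_lt_limit (R : realType) (F f : R -> R) (L : R) :
  (\forall t \near +oo, is_derive (t : R) 1 F (f t)) ->
  (\forall t \near +oo, 0 < f t) -> F t @[t --> +oo] --> L ->
  \forall t \near +oo, F t < L.
Proof.
move=> FE f0 FL.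
have [T T0 HT] : exists2 T : R, 0 <= T & forall t : R, T <= t -> is_derive t 1 F (f t) /\ 0 < f t.
  by apply: near_pinftyP; exact: filterI.
have Flt s t : T <= s -> s < t -> F s < F t.
  move=> Ts st; apply: (lt_of_derive_gt0 (df := f)) => // x /andP[sx _];
  by have [] := HT x (le_trans Ts sx).
apply: (@near_ge R T) => t Tt; have t1 : t < t + 1 by rewrite ltrDl.
apply: lt_le_trans (Flt _ _ Tt t1) _; apply: (cvgr_to_ge FL).
apply: (@near_ge R (t + 2)) => s ts; apply/ltW/Flt; last by lra.
by rewrite (le_trans Tt)// ltW.
Qed.

Section tail_asymptotics.
Context {R : realType}.
Notation mu := (@lebesgue_measure R).
Variables (a c rho : R) (G y dy : R -> R).
Hypotheses (cG : {within `[a, +oo[, continuous G}) (G0 : forall t, a <= t -> 0 < G t).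
Hypothesis c0 : 0 < c.
Hypothesis yE : \forall t \near +oo, is_derive (t : R) 1 y (dy t).
Hypothesis y0 : \forall t \near +oo, 0 < y t.
Hypothesis dy0 : \forall t \near +oo, 0 < dy t.
Hypothesis cdy : \forall t \near +oo, {for t, continuous dy}.
Hypothesis yG : dy t / y t / G t @[t --> +oo] --> c^-1.
Hypotheses (GR : RVlim rho G) (ySV : RVlim 0 y).

Let nG0 : \forall t \near +oo, 0 < G t. Proof. exact: near_ge G0. Qed.

(** [dy] is the product of [G], the slowly varying [y] and a factor with a positive limit, so only
    [G] contributes to the index. *)
Lemma RVlim_derivative : RVlim rho dy.
Proof.
move=> l l0; have ci : c^-1 != 0 by rewrite invr_eq0 gt_eqF.
have u2 := cvg_comp _ _ (cvg_mul_pinfty l0) yG.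
have -> : l `^ rho = c^-1 / c^-1 * l `^ 0 * l `^ rho by rewrite divff// powRr0 !mul1r.
apply: cvg_eq_near (cvgM (cvgM (cvgM u2 (cvgV ci yG)) (ySV l0)) (GR l0)).
near=> t => /=.
have Gt : 0 < G t by near: t.
have yt : 0 < y t by near: t.
have dyt : 0 < dy t by near: t.
have Glt : 0 < G (l * t) by near: t; exact: (near_mul_pinfty l0 nG0).
have ylt : 0 < y (l * t) by near: t; exact: (near_mul_pinfty l0 y0).
by field; rewrite !gt_eqF.
Unshelve. all: end_near. Qed.

Lemma increments_cvg_ln : rho = -1 -> forall l : R, 0 < l ->
  (y (l * t) - y t) / (t * dy t) @[t --> +oo] --> ln l.
Proof.
move=> rho1; have dR := RVlim_derivative; rewrite rho1 in dR.
have gt1 l : 1 < l -> (y (l * t) - y t) / (t * dy t) @[t --> +oo] --> ln l.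
  exact: karamata_increment_log yE dy0 cdy dR.
move=> l l0; case: (ltgtP l 1) => [l1|/gt1 //|->]; last first.
  by rewrite ln1; under eq_fun do rewrite mul1r subrr mul0r; exact: cvg_cst.
(* For [l < 1] the case of [l^-1] is read at [l * t]; the change of normalization
   [l * dy (l * t) / dy t] tends to 1 because [dy] has index -1. *)
have li : 1 < l^-1 by rewrite invf_gt1.
have lim : (y t - y (l * t)) / (l * t * dy (l * t)) @[t --> +oo] --> ln l^-1.
  apply: cvg_eq_near (cvg_comp _ _ (cvg_mul_pinfty l0) (gt1 _ li)).
  by near=> t => /=; rewrite mulKf ?gt_eqF.
have lim2 : l * (dy (l * t) / dy t) @[t --> +oo] --> l * l `^ (-1).
  by apply: cvgMl_tmp; exact: dR.
rewrite powR_inv1 ?(ltW l0)// divff ?gt_eqF// in lim2.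
have limN : - ((y t - y (l * t)) / (l * t * dy (l * t))) @[t --> +oo] --> - ln l^-1.
  exact: cvgN lim.
have -> : ln l = - ln (l^-1) * 1 by rewrite lnV ?posrE// opprK mulr1.
apply: cvg_eq_near (cvgM limN lim2); near=> t => /=.
have t0 : 0 < t by [].
have dyt : 0 < dy t by near: t.
have dylt : 0 < dy (l * t) by near: t; exact: (near_mul_pinfty l0 dy0).
by field; rewrite !gt_eqF.
Unshelve. all: end_near. Qed.

Variables (N l : R).
Let FG t := \int[mu]_(s in `[a, t]) G s.
Hypotheses (yN : y t @[t --> +oo] --> N) (FGl : FG t @[t --> +oo] --> l) (N0 : 0 < N).

Let FGE t : a < t -> is_derive t 1 FG (G t). Proof. exact: is_derive_Rintegral. Qed.
Let nFGE : \forall t \near +oo, is_derive (t : R) 1 FG (G t).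
Proof. by apply: filterS (nbhs_pinfty_gt (num_real a)) => t; exact: FGE. Qed.

(** [H], and [z] below, are the primitives of [G] and [dy] normalized to vanish at infinity:
    negative and increasing, as the 0/0 rule requires. Their opposites are the tail of [G] and
    [N - y]. *)
Let H t := FG t - l.
Let HE : \forall t \near +oo, is_derive (t : R) 1 H (G t).
Proof. by apply: filterS nFGE => t; exact: is_derive_subr. Qed.
Let Hn : \forall t \near +oo, H t < 0.
Proof.
by apply: filterS (primitive_lt_limit nFGE nG0 FGl) => t; rewrite subr_lt0.
Qed.
Let Hl : H t @[t --> +oo] --> 0.
Proof. by rewrite -(subrr l); apply: cvgB => //; exact: cvg_cst. Qed.

Let z t := y t - N.
Let zE : \forall t \near +oo, is_derive (t : R) 1 z (dy t).
Proof. by apply: filterS yE => t; exact: is_derive_subr. Qed.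
Let zn : \forall t \near +oo, z t < 0.
Proof. by apply: filterS (primitive_lt_limit yE dy0 yN) => t; rewrite subr_lt0. Qed.
Let zl : z t @[t --> +oo] --> 0.
Proof. by rewrite -(subrr N); apply: cvgB => //; exact: cvg_cst. Qed.

Lemma limit_gt : \forall t \near +oo, y t < N.
Proof. exact: primitive_lt_limit yE dy0 yN. Qed.

Lemma RintegralE_tail t : a <= t -> \int[mu]_(s in `[t, +oo[) G s = - H t.
Proof.
move=> at_; have [_ e] := Rintegral_tail cG (fun t at_ => ltW (G0 at_)) FGl at_.
by rewrite /Rintegral e /H opprB.
Qed.

Lemma tail_gt0 : \forall t \near +oo, 0 < \int[mu]_(s in `[t, +oo[) G s.
Proof.
apply: filterS2 Hn (nbhs_pinfty_ge (num_real a)) => t Ht at_.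
by rewrite RintegralE_tail// oppr_gt0.
Qed.

Lemma tail_continuous t : a < t -> {for t, continuous (fun t => \int[mu]_(s in `[t, +oo[) G s)}.
Proof.
move=> at_; apply: (@continuous_near_eq R _ (fun t => - H t)).
  by near=> x; apply: RintegralE_tail; apply: ltW; near: x; exact: lt_nbhsr.
by apply: cvgN; exact: is_derive_continuous (is_derive_subr l (FGE at_)).
Unshelve. all: end_near. Qed.

Lemma tail_RVlim : RVlim (rho + 1) (fun t => \int[mu]_(s in `[t, +oo[) G s).
Proof.
apply: (@RVlim_near_eq _ _ (fun t => -1 * H t)).
  by apply: (@near_ge R a) => t /RintegralE_tail ->; rewrite mulN1r.
apply: RVlim_scale; first by rewrite oppr_eq0 oner_eq0.
exact: RVlim_primitive_0 HE nG0 GR Hl Hn.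
Qed.

Lemma remainder_RVlim : RVlim (rho + 1) (fun t => N - y t).
Proof.
apply: (@RVlim_near_eq _ _ (fun t => -1 * z t)).
  by near=> t; rewrite mulN1r opprB.
apply: RVlim_scale; first by rewrite oppr_eq0 oner_eq0.
exact: RVlim_primitive_0 zE dy0 RVlim_derivative zl zn.
Unshelve. all: end_near. Qed.

Lemma derivative_asymp : dy t / G t @[t --> +oo] --> N / c.
Proof.
rewrite mulrC; apply: cvg_eq_near (cvgM yG yN); near=> t => /=.
have yt : 0 < y t by near: t.
have Gt : 0 < G t by near: t.
by field; rewrite !gt_eqF.
Unshelve. all: end_near. Qed.

(** By the 0/0 rule [z / H] has the limit of [dy / G], which is [N / c] because [dy / (y * G)] tends
    to [c^-1] and [y] to [N]. *)
Lemma remainder_asymp :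
  (N - y t) / (N / c * \int[mu]_(s in `[t, +oo[) G s) @[t --> +oo] --> (1 : R).
Proof.
have Nc : N / c != 0 by rewrite mulf_neq0 ?invr_eq0 ?gt_eqF.
have zH := lhopital_pinfty_0 zE HE nG0 derivative_asymp zl Hl Hn.
rewrite -[X in _ --> X](mulVf Nc).
apply: cvg_eq_near (cvgMl_tmp (a := (N / c)^-1) zH); near=> t.
have at_ : a <= t by near: t; apply: nbhs_pinfty_ge; exact: num_real.
have Ht : H t < 0 by near: t.
rewrite RintegralE_tail// -(opprB (y t)) -/(z t).
by field; rewrite (lt_eqF Ht) !gt_eqF.
Unshelve. all: end_near. Qed.

(** Karamata's boundary case applied to [dy] makes [t * dy t] negligible against [N - y t]; [dy] is
    then exchanged for [G] through the limit [N / c] of their quotient. *)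
Lemma boundary_remainder : rho = -1 -> t * G t / (N - y t) @[t --> +oo] --> 0.
Proof.
move=> rho1; have dR := RVlim_derivative; rewrite rho1 in dR.
have Nc : N / c != 0 by rewrite mulf_neq0 ?invr_eq0 ?gt_eqF.
have lim := karamata_boundary_0 zE dy0 cdy dR zl zn.
have limN : - (t * dy t / z t) @[t --> +oo] --> - 0 by exact: cvgN lim.
have -> : 0 = - 0 * (N / c)^-1 :> R by rewrite oppr0 mul0r.
apply: cvg_eq_near (cvgM limN (cvgV Nc derivative_asymp)); near=> t => /=.
have zt : z t < 0 by near: t.
have Gt : 0 < G t by near: t.
have dyt : 0 < dy t by near: t.
rewrite -(opprB (y t)) -/(z t).
by field; rewrite (lt_eqF zt) !gt_eqF.
Unshelve. all: end_near. Qed.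

End tail_asymptotics.

(** * Solutions of the delay equation *)

Lemma RV_of_continuous (R : realType) (f : R -> R) (theta : R) :
  (\forall t \near +oo, {for t, continuous f}) -> (\forall t \near +oo, 0 < f t) ->
  RVlim theta f -> RV theta f.
Proof.
move=> cf f0 fth; split=> //.
have [T _ HT] : exists2 T : R, 0 <= T & forall t : R, T <= t ->
  {for t, continuous f} /\ 0 < f t by apply: near_pinftyP; exact: filterI.
exists T; split=> [|t /HT[]//].
by apply: within_itvcy_measurable; apply: continuous_within_itvcy => t /HT[].
Qed.

Lemma conjugate_sub1M (R : realType) (alpha beta : R) :
  1 < alpha -> alpha^-1 + beta^-1 = 1 -> (alpha - 1) * (beta - 1) = 1.
Proof.
move=> a1 ab; have a0 : alpha != 0 by rewrite gt_eqF// (lt_trans ltr01).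
have b0 : beta != 0.
  apply/eqP => b0; move: ab a1; rewrite b0 invr0 addr0 => /(congr1 GRing.inv).
  by rewrite invrK invr1 => ->; rewrite ltxx.
have : alpha * beta * (alpha^-1 + beta^-1) = alpha + beta by field; rewrite ?a0 ?b0.
by rewrite ab mulr1 => e; rewrite mulrBl mulrBr e; ring.
Qed.

Lemma limf_esup_ratio_le (R : realType) (tau : R -> R) :
  (limf_esup (fun t : R => (t / tau t)%:E) (pinfty_nbhs R) < +oo)%E ->
  tau t @[t --> +oo] --> +oo -> exists M : R, \forall t \near +oo, t <= M * tau t.
Proof.
move=> /ereal_inf_lt[_ [V nV <-] Vlt] tauoo.
(* The supremum over [V] may formally be real or minus infinity; in the latter case any real bound
   serves, here 0. *)
have [M VM] : exists M : R, (ereal_sup [set (t / tau t)%:E | t in V] <= M%:E)%E.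
  case: (ereal_sup _) Vlt => [M _|//|_]; first by exists M; exact: lexx.
  by exists 0; exact: leNye.
exists M; have nV' : \forall t \near +oo, V t by exact: nV.
near=> t.
have taut : 0 < tau t by near: t; move/cvgryPgt : tauoo; exact.
have Vt : V t by near: t.
rewrite -ler_pdivrMr// -lee_fin (le_trans _ VM)//; apply: ereal_sup_ubound.
by exists t.
Unshelve. all: end_near. Qed.

Section main.
Context {R : realType}.
Notation mu := (@lebesgue_measure R).
Variables (a alpha beta : R) (r p tau : R -> R).
Let G := Gfun beta r p.
Let S := solS a alpha r p tau.
Let IS := solIS a alpha r p tau.
Hypotheses (a0 : 0 < a) (alpha1 : 1 < alpha) (ab : (alpha - 1) * (beta - 1) = 1).
Hypotheses (cr : {within `[a, +oo[, continuous r})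
           (cp : {within `[a, +oo[, continuous p})
           (r0 : forall t, a <= t -> 0 < r t) (p0 : forall t, a <= t -> 0 < p t).
Hypothesis taule : forall t, a <= t -> tau t <= t.
Hypothesis tauM : exists M : R, \forall t \near +oo, t <= M * tau t.
Hypothesis tauoo : tau t @[t --> +oo] --> +oo.
Hypothesis poo : (\int[mu]_(s in `[a, +oo[) (p s)%:E = +oo)%E.
Let P t := \int[mu]_(s in `[a, t]) p s.
Hypothesis small : t `^ (alpha - 1) / r t * P t @[t --> +oo] --> 0.

Let b0 : 0 < beta - 1.
Proof. by rewrite -(@pmulr_rgt0 _ (alpha - 1)) ?ab// subr_gt0. Qed.

Let PE : \forall t \near +oo, is_derive (t : R) 1 P (p t).
Proof. by apply: filterS (nbhs_pinfty_gt (num_real a)) => t; exact: is_derive_Rintegral. Qed.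

Let Poo : P t @[t --> +oo] --> +oo.
Proof. by apply: Rintegral_cvg_pinfty => // t /p0/ltW. Qed.

Let np0 : \forall t \near +oo, 0 < p t. Proof. exact: near_ge p0. Qed.
Let nr0 : \forall t \near +oo, 0 < r t. Proof. exact: near_ge r0. Qed.
Let ntaule : \forall t \near +oo, tau t <= t. Proof. exact: near_ge taule. Qed.
Let ncp : \forall t \near +oo, {for t, continuous p}.
Proof.
by apply: filterS (nbhs_pinfty_gt (num_real a)) => t; exact: within_itvcy_continuous.
Qed.

Let GE t : a <= t -> G t = (t * p t / r t) `^ (beta - 1).
Proof.
move=> at_; rewrite /G /Gfun Phi_gt0E// divr_gt0 ?r0// mulr_gt0 ?p0//.
exact: lt_le_trans at_.
Qed.

Let tpr0 t : a <= t -> 0 < t * p t / r t.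
Proof.
by move=> at_; rewrite divr_gt0 ?r0// mulr_gt0 ?p0// (lt_le_trans a0).
Qed.

Let G0 t : a <= t -> 0 < G t.
Proof. by move=> at_; rewrite GE// powR_gt0// tpr0. Qed.

Let nG0 : \forall t \near +oo, 0 < G t. Proof. exact: near_ge G0. Qed.

Lemma Gfun_continuous : {within `[a, +oo[, continuous G}.
Proof.
have : {within `[a, +oo[, continuous (fun t => (t * p t / r t) `^ (beta - 1))}.
  rewrite continuous_subspace_in => t; rewrite inE/= in_itv/= andbT => at_.
  apply: (continuous_cvg _ (is_derive_continuous (is_derive1_powR (beta - 1) (tpr0 at_)))).
  apply: cvgM; last by apply: cvgV; [exact: lt0r_neq0 (r0 at_)|exact: cr].
  apply: cvgM; last exact: cp.
  by apply: (continuous_subspaceT (fun x => @cvg_id R (nbhs x))).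
apply: subspace_eq_continuous => t; rewrite inE/= in_itv/= andbT => /GE.
by [].
Qed.

Let FG t := \int[mu]_(s in `[a, t]) G s.
Let FGE t : a < t -> is_derive t 1 FG (G t).
Proof. by apply: is_derive_Rintegral; exact: Gfun_continuous. Qed.
Let nFGE : \forall t \near +oo, is_derive (t : R) 1 FG (G t).
Proof. by apply: filterS (nbhs_pinfty_gt (num_real a)) => t; exact: FGE. Qed.

Section one_solution.
Variable y : R -> R.
Hypothesis Sy : S y.

Let yT : exists2 T0 : R, a < T0 & forall t : R, T0 <= t ->
    [/\ is_derive t 1 y (derive1 y t),
        is_derive t 1 (quasi alpha r y) (p t * y (tau t) `^ (alpha - 1)),
        0 < y t & {for t, continuous (derive1 y)}].
Proof.
have [T0 HT] := solS_eventually tauoo Sy.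
exists (Num.max (a + 1) T0); first by rewrite lt_max ltrDl ltr01.
by move=> t; rewrite ge_max => /andP[_ /HT].
Qed.

Lemma S_near : [/\ \forall t \near +oo, is_derive (t : R) 1 y (derive1 y t),
    \forall t \near +oo, is_derive (t : R) 1 (quasi alpha r y) (p t * y (tau t) `^ (alpha - 1)),
    \forall t \near +oo, 0 < y t & \forall t \near +oo, {for t, continuous (derive1 y)}].
Proof.
by have [T aT HT] := yT; split; apply: (@near_ge R T) => t /HT[].
Qed.

Lemma S_NSV_SV : NSV y -> SV y.
Proof.
have [yE _ y0 _] := S_near.
move=> /NSV_RVlim; apply: RV_of_continuous => //.
by apply: filterS yE => t; exact: is_derive_continuous.
Qed.

(** The quasiderivative is eventually nondecreasing and has the sign of [derive1 y]: either it is
    positive somewhere and stays so, or it is never positive and [nonincreasing_not_SV] applies. *)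
Lemma S_SV_IS delta : -1 < delta -> RVlim delta p -> SV y -> IS y.
Proof.
move=> d1 pd [_ ysv]; split=> //; have [yE qE y0 _] := S_near.
have [T aT HT] := yT.
have qle s t : T <= s -> s <= t -> quasi alpha r y s <= quasi alpha r y t.
  move=> Ts st; apply: (le_of_derive_ge0
    (df := fun t => p t * y (tau t) `^ (alpha - 1)) st) => x /andP[sx _].
    by have [] := HT x (le_trans Ts sx).
  by rewrite mulr_ge0 ?powR_ge0// ltW// p0// (le_trans (ltW aT))// (le_trans Ts).
have qdy t : T <= t -> (0 < quasi alpha r y t) = (0 < derive1 y t).
  move=> Tt; rewrite /quasi pmulr_rgt0 ?Phi_gt0// r0//.
  exact: le_trans (ltW aT) Tt.
have [[t0 Tt0 q0]|nq] := pselect (exists2 t, T <= t & 0 < quasi alpha r y t).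
  apply: (@near_ge R t0) => t t0t; rewrite -(qdy t (le_trans Tt0 t0t)).
  exact: lt_le_trans q0 (qle _ _ Tt0 t0t).
exfalso.
have qn t : T <= t -> quasi alpha r y t <= 0.
  by move=> Tt; rewrite leNgt; apply/negP => qt; apply: nq; exists t.
have dn t : T <= t -> derive1 y t <= 0.
  by move=> Tt; rewrite leNgt -(qdy t Tt) -leNgt qn.
have y2 := ysv 2 (ltr0n R 2); rewrite powRr0 in y2.
exact: (nonincreasing_not_SV alpha1 np0 PE Poo ntaule tauoo yE y0 qE d1 pd
  (near_ge dn) (near_ge qn) y2).
Qed.

Hypothesis dy0 : \forall t \near +oo, 0 < derive1 y t.

Let qy : \forall t \near +oo, quasi alpha r y t = r t * derive1 y t `^ (alpha - 1).
Proof. by apply: filterS dy0 => t dyt; rewrite /quasi Phi_gt0E. Qed.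

Let lds : t * derive1 y t / y t @[t --> +oo] --> 0.
Proof.
have [yE qE y0 _] := S_near.
exact: (log_derivative_cvg0 alpha1 np0 nr0 PE Poo ntaule tauoo yE y0 qE dy0 qy small).
Qed.

Lemma IS_NSV : NSV y.
Proof. by have [yE _ y0 cdy] := S_near; exact: log_derivative_NSV lds. Qed.

Lemma IS_SV : SV y.
Proof. exact/S_NSV_SV/IS_NSV. Qed.

Section regularly_varying_p.
Variable delta : R.
Hypotheses (d1 : -1 < delta) (pd : RVlim delta p).

Let kar : P t / (t * p t) @[t --> +oo] --> (delta + 1)^-1.
Proof. exact: karamata_primitive_oo PE np0 ncp pd d1 Poo. Qed.

Let ydelay : y (tau t) / y t @[t --> +oo] --> (1 : R).
Proof.
have [M HM] := tauM; have [yE _ y0 _] := S_near.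
exact: (delayed_ratio_cvg1 ntaule tauoo yE y0 dy0 lds HM).
Qed.

Lemma IS_quasi_cvg_pinfty : quasi alpha r y t @[t --> +oo] --> +oo.
Proof.
have [yE qE y0 _] := S_near.
exact: (quasi_cvg_pinfty alpha1 np0 PE Poo tauoo yE y0 qE dy0 lds ydelay kar).
Qed.

Lemma IS_log_derivative :
  derive1 y t / y t / G t @[t --> +oo] --> (Phi beta (delta + 1))^-1.
Proof.
have [yE qE y0 _] := S_near.
rewrite Phi_gt0E -?ltrBlDr ?sub0r//.
apply: cvg_eq_near (log_derivative_asymp alpha1 ab np0 nr0 PE Poo tauoo yE y0 qE dy0 qy
  lds ydelay d1 kar).
by apply: (@near_ge R a) => t /GE ->.
Qed.

End regularly_varying_p.
End one_solution.

(** * Solution sets, representations and indices for regularly varying coefficients *)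

Section regularly_varying_coefficients.
Variable delta : R.
Hypotheses (d1 : -1 < delta) (pd : RVlim delta p).
Let c := Phi beta (delta + 1).

Let c0 : 0 < c.
Proof. by rewrite /c Phi_gt0 -ltrBlDr sub0r. Qed.

(** The equalities close the cycle of inclusions from [IS] to [NSV], from [NSV] to [SV] within [S],
    and from [SV] back to [IS]. *)
Lemma slowly_varying_solutions :
  [/\ S `&` NSV = S `&` SV, S `&` SV = IS & IS `<=` NSV].
Proof.
have ISN : IS `<=` NSV by move=> y [Sy dy]; exact: IS_NSV.
have SVIS : S `&` SV = IS.
  apply/seteqP; split=> y [Sy]; first by exact: S_SV_IS d1 pd.
  by move=> dy; split=> //; exact: IS_SV.
split=> //; apply/seteqP; split=> y [Sy yN]; split=> //; first exact: S_NSV_SV.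
by apply: ISN; rewrite -SVIS.
Qed.

(** The quasiderivative of every increasing solution tends to infinity, so the two cases of the
    theorem differ only in the limit of [y]. *)
Lemma solIS_limits (u : limval) : (forall y, IS y -> has_limval y u) ->
  IS = solISlim a alpha r p tau u LimInf.
Proof.
move=> ISu; apply/seteqP; split=> y; last by case.
move=> ISy; split=> //; first exact: ISu.
by case: ISy => Sy dy; exact: IS_quasi_cvg_pinfty d1 pd.
Qed.

Lemma FG_cvg_pinfty : (\int[mu]_(s in `[a, +oo[) (G s)%:E = +oo)%E ->
  FG t @[t --> +oo] --> +oo.
Proof. by apply: Rintegral_cvg_pinfty; [exact: Gfun_continuous|move=> t /G0/ltW]. Qed.

Lemma FG_cvg : (\int[mu]_(s in `[a, +oo[) (G s)%:E < +oo)%E ->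
  exists l : R, FG t @[t --> +oo] --> l.
Proof. by apply: Rintegral_cvg_lty; [exact: Gfun_continuous|move=> t /G0/ltW]. Qed.

Lemma IS_unbounded y : (\int[mu]_(s in `[a, +oo[) (G s)%:E = +oo)%E -> IS y ->
  y t @[t --> +oo] --> +oo.
Proof.
move=> /FG_cvg_pinfty Goo [Sy dy]; have [yE _ y0 cdy] := S_near Sy.
exact: relative_growth_cvg_pinfty Gfun_continuous G0 c0 yE y0 cdy
  (IS_log_derivative Sy dy d1 pd) Goo.
Qed.

Lemma IS_bounded y : (\int[mu]_(s in `[a, +oo[) (G s)%:E < +oo)%E -> IS y ->
  exists2 N : R, 0 < N & y t @[t --> +oo] --> N.
Proof.
move=> /FG_cvg[l Gl] [Sy dy]; have [yE _ y0 cdy] := S_near Sy.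
exact: (relative_growth_cvg Gfun_continuous G0 c0 yE y0 cdy
  (IS_log_derivative Sy dy d1 pd) Gl).
Qed.

Lemma IS_exp_integral y : IS y -> exists eps : R -> R, eps s @[s --> +oo] --> 0 /\
  \forall t \near +oo,
    mu.-integrable `[a, t] (fun s => ((1 + eps s) * (G s / c))%:E) /\
    y t = expR (\int[mu]_(s in `[a, t]) ((1 + eps s) * (G s / c))).
Proof.
move=> [Sy dy]; have [yE _ y0 cdy] := S_near Sy.
exact: exp_integral_representation Gfun_continuous G0 c0 yE y0 cdy
  (IS_log_derivative Sy dy d1 pd).
Qed.

Lemma IS_exp_tail y (N : R) : IS y -> 0 < N -> y t @[t --> +oo] --> N ->
  exists eps : R -> R, eps s @[s --> +oo] --> 0 /\
  \forall t \near +oo,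
    mu.-integrable `[t, +oo[ (fun s => ((1 + eps s) * (G s / c))%:E) /\
    y t = N * expR (- \int[mu]_(s in `[t, +oo[) ((1 + eps s) * (G s / c))).
Proof.
move=> [Sy dy] N0 yN; have [yE _ y0 cdy] := S_near Sy.
exact: (exp_tail_representation G0 c0 yE y0 cdy
  (IS_log_derivative Sy dy d1 pd) N0 yN).
Qed.

Variable gamma : R.
Hypothesis rg : RVlim gamma r.

(** The quantity assumed to tend to 0 is regularly varying of index [alpha + delta - gamma]; a
    positive index would make it unbounded. *)
Lemma index_le : alpha + delta <= gamma.
Proof.
rewrite leNgt; apply/negP => glt.
have two0 : 0 < 2 :> R by [].
have PR := RVlim_primitive_oo PE np0 pd Poo two0.
have g2 : 2 `^ gamma != 0 :> R by rewrite gt_eqF// powR_gt0.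
apply: (@no_bounded_growth R (fun t => t `^ (alpha - 1) / r t * P t)
  (2 `^ (alpha - 1) * (2 `^ gamma)^-1 * 2 `^ (delta + 1)) 1).
- near=> t; have rt : 0 < r t by near: t.
  have Pt : 0 < P t by near: t; move/cvgryPgt : Poo; exact.
  have t0 : 0 < t by [].
  by rewrite mulr_gt0// divr_gt0// powR_gt0.
- apply: cvg_eq_near (cvgM (cvgMl_tmp (a := 2 `^ (alpha - 1)) (cvgV g2 (rg two0))) PR).
  near=> t => /=.
  have rt : 0 < r t by near: t.
  have r2t : 0 < r (2 * t) by near: t; exact: (near_mul_pinfty two0 nr0).
  have Pt : 0 < P t by near: t; move/cvgryPgt : Poo; exact.
  have t0 : 0 < t by [].
  have tt : 0 < t `^ (alpha - 1) by exact: powR_gt0.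
  rewrite powRM ?(ltW t0)// ?(ltW two0)//.
  by field; rewrite !gt_eqF.
- rewrite -powRN -powRD_gt0// -powRD_gt0// -[ltLHS](powRr0 2) /powR gt_eqF//.
  by rewrite ltr_expR ltr_pM2r ?ln_gt0 ?ltr1n//; lra.
- exact: (cvgr_le _ small _ ltr01).
Unshelve. all: end_near. Qed.

(** The index of [G]. Since [(alpha - 1) * (beta - 1) = 1], it equals -1 when
    [gamma = alpha + delta] and is smaller when [gamma] is larger. *)
Let rho := (delta + 1 - gamma) * (beta - 1).

Lemma Gfun_RVlim : RVlim rho G.
Proof.
move=> l l0.
have lg : l `^ gamma != 0 by rewrite gt_eqF// powR_gt0.
have lim : l * (p (l * t) / p t) * (r (l * t) / r t)^-1 @[t --> +oo] -->
    l * l `^ delta * (l `^ gamma)^-1.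
  apply: cvgM; last exact: cvgV lg (rg l0).
  by apply: cvgMl_tmp; exact: pd.
have lE : l * l `^ delta * (l `^ gamma)^-1 = l `^ (delta + 1 - gamma).
  by rewrite !powRD_gt0// powRN powRr1 ?(ltW l0)// [l * _]mulrC.
rewrite lE in lim; rewrite /rho powRrM.
apply: cvg_eq_near (cvg_powR (powR_gt0 _ l0) lim); near=> t.
have t0 : 0 < t by [].
have at_ : a <= t by near: t; apply: nbhs_pinfty_ge; exact: num_real.
have alt : a <= l * t.
  by near: t; exact: (near_mul_pinfty l0 (nbhs_pinfty_ge (num_real a))).
rewrite !GE// -powR_divr ?tpr0//; congr (_ `^ _).
have := p0 at_; have := p0 alt; have := r0 at_; have := r0 alt => h1 h2 h3 h4.
by field; rewrite !gt_eqF.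
Unshelve. all: end_near. Qed.

Let rho1 : gamma = alpha + delta -> rho = -1.
Proof.
move=> g; rewrite /rho g; have -> : delta + 1 - (alpha + delta) = - (alpha - 1) by ring.
by rewrite mulNr ab.
Qed.

Lemma IS_dehaan y : gamma = alpha + delta -> IS y ->
  dehaan_Pi (fun t => t * derive1 y t) y.
Proof.
move=> g [Sy dy]; have [yE _ y0 cdy] := S_near Sy.
have [[T [my _]] ySV] := IS_SV Sy dy.
split; first by exists T.
  by near=> t; rewrite mulr_gt0//; near: t.
exact: (increments_cvg_ln G0 c0 yE y0 dy cdy (IS_log_derivative Sy dy d1 pd)
  Gfun_RVlim ySV (rho1 g)).
Unshelve. all: end_near. Qed.

Lemma integral_lty_of_index_lt : alpha + delta < gamma ->
  (\int[mu]_(s in `[a, +oo[) (G s)%:E < +oo)%E.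
Proof.
move=> glt; apply: (integral_lty_RVlim Gfun_continuous G0 Gfun_RVlim).
rewrite -ab -mulNr ltr_pM2r//; lra.
Qed.

Lemma IS_remainder y : (\int[mu]_(s in `[a, +oo[) (G s)%:E < +oo)%E -> IS y ->
  exists N : R, [/\ 0 < N, y t @[t --> +oo] --> N,
    asymp (fun t : R => N - y t) (fun t : R => N / c * \int[mu]_(s in `[t, +oo[) G s),
    RV (rho + 1) (fun t : R => N / c * \int[mu]_(s in `[t, +oo[) G s) &
    RV (rho + 1) (fun t => N - y t) /\
    (gamma = alpha + delta -> SV (fun t => `|N - y t|) /\
      Lpart delta p t `^ (beta - 1) / (Lpart gamma r t `^ (beta - 1) * (N - y t))
        @[t --> +oo] --> 0)].
Proof.
move=> Goo ISy; have [N N0 yN] := IS_bounded Goo ISy; have [l Gl] := FG_cvg Goo.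
have [Sy dy] := ISy; have [yE _ y0 cdy] := S_near Sy; have [_ ySV] := IS_SV Sy dy.
have yG := IS_log_derivative Sy dy d1 pd.
have Nc : 0 < N / c by exact: divr_gt0.
have nyN := limit_gt yE dy yN.
have cNy : \forall t \near +oo, {for t, continuous (fun t => N - y t)}.
  apply: filterS yE => t yt; apply: cvgB; first exact: cvg_cst.
  exact: is_derive_continuous yt.
have Ny0 : \forall t \near +oo, 0 < N - y t by apply: filterS nyN => t; rewrite subr_gt0.
have NyR := remainder_RVlim G0 c0 yE y0 dy yG Gfun_RVlim ySV yN.
exists N; split=> //.
- exact: (remainder_asymp Gfun_continuous G0 c0 yE y0 yG yN Gl N0).
- apply: RV_of_continuous.
  + apply: filterS (nbhs_pinfty_gt (num_real a)) => t at_.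
    apply: cvgM; first exact: cvg_cst.
    exact: (tail_continuous Gfun_continuous G0 Gl at_).
  + by apply: filterS (tail_gt0 Gfun_continuous G0 Gl) => t ?; rewrite mulr_gt0.
  + apply: RVlim_scale; first exact: lt0r_neq0.
    exact: (tail_RVlim Gfun_continuous G0 Gfun_RVlim Gl).
split; first exact: RV_of_continuous.
move=> g; rewrite (rho1 g) addNr in NyR; split.
  apply: RV_of_continuous.
  - by apply: filterS cNy => t; exact: cvg_norm.
  - by apply: filterS Ny0 => t ?; rewrite normr_gt0 lt0r_neq0.
  - by apply: RVlim_near_eq NyR; apply: filterS Ny0 => t ?; rewrite gtr0_norm.
(* In the boundary case the powers of [t] in [G] combine to the exponent -1, so the quotient of the
   slowly varying parts, raised to the power [beta - 1], is exactly [t * G t]. *)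
apply: cvg_eq_near (boundary_remainder G0 c0 yE y0 dy cdy yG Gfun_RVlim ySV yN N0 (rho1 g)).
near=> t.
have t0 : 0 < t by [].
have at_ : a <= t by near: t; apply: nbhs_pinfty_ge; exact: num_real.
have pt := p0 at_; have rt := r0 at_.
have Nyt : 0 < N - y t by near: t.
have tb x : 0 < t `^ x by exact: powR_gt0.
rewrite GE// /Lpart powR_divr// powR_divr// powR_divr ?mulr_gt0// powRM ?(ltW t0) ?(ltW pt)//.
rewrite -!powRrM g.
have -> : (alpha + delta) * (beta - 1) = 1 + (beta - 1) + delta * (beta - 1).
  by rewrite -{2}ab; ring.
rewrite (powRD_gt0 (1 + _) _ t0) (powRD_gt0 1 _ t0) powRr1 ?(ltW t0)//.
have := tb (beta - 1); have := tb (delta * (beta - 1)) => h1 h2.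
have := powR_gt0 (beta - 1) pt; have := powR_gt0 (beta - 1) rt => h3 h4.
by field; rewrite !gt_eqF.
Unshelve. all: end_near. Qed.

End regularly_varying_coefficients.
End main.

Theorem theorem3p1 (R : realType) (a alpha beta : R)
    (r p tau dtau : R -> R)
    (mu := @lebesgue_measure R)
    (G := Gfun beta r p)
    (S := solS a alpha r p tau)
    (IS := solIS a alpha r p tau) :
  0 < a ->
  1 < alpha ->
  alpha^-1 + beta^-1 = 1 ->
  {within `[a, +oo[, continuous r} ->
  {within `[a, +oo[, continuous p} ->
  (forall t, a <= t -> 0 < r t) ->
  (forall t, a <= t -> 0 < p t) ->
  C1_on `[a, +oo[ tau dtau ->
  (forall t, a <= t -> 0 < dtau t) ->
  (forall t, a <= t -> tau t <= t) ->
  (limf_esup (fun t : R => (t / tau t)%:E) (pinfty_nbhs R) < +oo)%E ->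
  tau t @[t --> +oo] --> +oo ->
  (\int[mu]_(s in `[a, +oo[) (p s)%:E = +oo)%E ->
  (fun t : R => t `^ (alpha - 1) / r t * \int[mu]_(s in `[a, t]) p s) @ +oo
    --> 0 ->
  IS `<=` NSV /\
  forall delta : R, -1 < delta -> RV delta p ->
  [/\ (\int[mu]_(s in `[a, +oo[) (G s)%:E = +oo)%E ->
      (forall y, IS y ->
        exists eps : R -> R, eps s @[s --> +oo] --> 0 /\
          \forall t \near +oo,
            mu.-integrable `[a, t]
              (fun s => ((1 + eps s) * (G s / Phi beta (delta + 1)))%:E) /\
            y t = expR (\int[mu]_(s in `[a, t])
                          ((1 + eps s) * (G s / Phi beta (delta + 1))))) /\
      [/\ S `&` NSV = S `&` SV, S `&` SV = IS &
          IS = solISlim a alpha r p tau LimInf LimInf],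
      (\int[mu]_(s in `[a, +oo[) (G s)%:E < +oo)%E ->
      (forall y, IS y ->
        exists N : R, [/\ 0 < N, y t @[t --> +oo] --> N &
        exists eps : R -> R, eps s @[s --> +oo] --> 0 /\
          \forall t \near +oo,
            mu.-integrable `[t, +oo[
              (fun s => ((1 + eps s) * (G s / Phi beta (delta + 1)))%:E) /\
            y t = N * expR (- \int[mu]_(s in `[t, +oo[)
                          ((1 + eps s) * (G s / Phi beta (delta + 1))))]) /\
      [/\ S `&` NSV = S `&` SV, S `&` SV = IS &
          IS = solISlim a alpha r p tau LimB LimInf] &
      forall gamma : R, RV gamma r ->
      [/\ alpha + delta <= gamma,
          gamma = alpha + delta ->
          forall y, IS y -> dehaan_Pi (fun t : R => t * derive1 y t) y &
          (gamma = alpha + delta /\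
             (\int[mu]_(s in `[a, +oo[) (G s)%:E < +oo)%E) \/
          alpha + delta < gamma ->
          forall y, IS y ->
          exists N : R, [/\ 0 < N, y t @[t --> +oo] --> N,
            asymp (fun t : R => N - y t)
              (fun t : R => N / Phi beta (delta + 1) *
                        \int[mu]_(s in `[t, +oo[) G s),
            RV ((delta + 1 - gamma) * (beta - 1) + 1)
               (fun t : R => N / Phi beta (delta + 1) *
                         \int[mu]_(s in `[t, +oo[) G s) &
            RV ((delta + 1 - gamma) * (beta - 1) + 1) (fun t => N - y t) /\
            (gamma = alpha + delta ->
             SV (fun t => `|N - y t|) /\
             Lpart delta p t `^ (beta - 1) /
               (Lpart gamma r t `^ (beta - 1) * (N - y t))
               @[t --> +oo] --> 0)]]].
Proof.
move=> a0 alpha1 /(conjugate_sub1M alpha1) ab cr cp r0 p0 _ _ taule limsup tauoo poo small.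
have tauM := limf_esup_ratio_le limsup tauoo.
split=> [y [Sy dy]|delta d1 [_ pd]].
  exact: (IS_NSV alpha1 cp r0 p0 taule tauoo poo small Sy dy).
have [NSVSV SVIS _] := slowly_varying_solutions alpha1 cp r0 p0 taule tauoo poo small d1 pd.
have limits := solIS_limits alpha1 cp r0 p0 taule tauM tauoo poo small d1 pd.
split.
- move=> Goo; split=> [y ISy|].
    exact: (IS_exp_integral a0 alpha1 ab cr cp r0 p0 taule tauM tauoo poo small d1 pd ISy).
  split=> //; apply: limits => y ISy.
  exact: (IS_unbounded a0 alpha1 ab cr cp r0 p0 taule tauM tauoo poo small d1 pd Goo ISy).
- move=> Goo.
  have bounded y (ISy : IS y) :=
    IS_bounded a0 alpha1 ab cr cp r0 p0 taule tauM tauoo poo small d1 pd Goo ISy.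
  split=> [y ISy|].
    have [N N0 yN] := bounded y ISy; exists N; split=> //.
    exact: (IS_exp_tail a0 alpha1 ab cp r0 p0 taule tauM tauoo poo small d1 pd ISy N0 yN).
  split=> //; apply: limits => y ISy.
  by have [N N0 yN] := bounded y ISy; exists N => //; exact: lt0r_neq0.
- move=> gamma [_ rg]; split.
  + exact: (index_le cp r0 p0 poo small pd rg).
  + move=> g y ISy.
    exact: (IS_dehaan a0 alpha1 ab cp r0 p0 taule tauM tauoo poo small d1 pd rg g ISy).
  + move=> cond y ISy.
    apply: (IS_remainder a0 alpha1 ab cr cp r0 p0 taule tauM tauoo poo small d1 pd rg _ ISy).
    case: cond => [[_ //]|glt].
    exact: (integral_lty_of_index_lt a0 alpha1 ab cr cp r0 p0 pd rg glt).
Qed.
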